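(* Fix $j\in\mathbb N$ and write $\phi=\phi_j$, $\lambda=\lambda_j$. Let $Q(y)=y\phi'(y)$ at those $y\in[0,1]$ where $\phi'(y)$ exists and is finite, let $P(x)=-\lambda\int_0^1K(x,y)Q(y)\,dy$ for $0\le x\le1$, and for $h\in\mathbb N$ let $a_h=\int_0^1P(x)\phi_h(x)\,dx$. Then the series $a_1\phi_1(x)+a_2\phi_2(x)+a_3\phi_3(x)+\cdots$ converges both absolutely and uniformly on $[0,1]$, and $\sum_{h=1}^\infty a_h\phi_h(x)=P(x)$ for every $0\le x\le1$.
   Context: Let $K:[0,1]\times[0,1]\to\mathbb R$ be defined by $K(x,y)=\frac12-\{(xy)^{-1}\}$ if $0<x,y\le 1$, and $K(x,y)=0$ if $0\le x,y\le1$ and $xy=0$, where $\{\alpha\}=\alpha-\lfloor\alpha\rfloor$. Let $L^2([0,1])$ denote the space of real-valued Lebesgue measurable square-integrable functions on $[0,1]$, with $\langle f,g\rangle=\int_0^1 f(x)g(x)\,dx$ and $\|f\|=\langle f,f\rangle^{1/2}$. A function $\phi$ is an eigenfunction of $K$ (with eigenvalue $\lambda\in\mathbb R$) if $\phi\in L^2([0,1])$, $\|\phi\|>0$, and $\phi(x)=\lambda\int_0^1 K(x,y)\phi(y)\,dy$ for every $x\in[0,1]$. Let $\phi_1,\phi_2,\ldots$ be a maximal orthonormal system in $L^2([0,1])$ of eigenfunctions of $K$, $\phi_j$ having the nonzero real eigenvalue $\lambda_j$, numbered so that $0<|\lambda_1|\le|\lambda_2|\le\cdots$ and $\lambda_j\ge\lambda_{j+1}$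 whenever $|\lambda_j|=|\lambda_{j+1}|$. (The derivative $\phi'$ exists at all points of $(0,1]$ outside a countable set, and $Q$ is measurable and square integrable on $[0,1]$, so $P$ and the $a_h$ are well defined real numbers/functions.) *)

(* Defs.v *)
From HB Require Import structures.
From mathcomp Require Import all_boot all_order all_algebra.
From mathcomp Require Import all_classical all_reals all_analysis.
Set Implicit Arguments. Unset Strict Implicit. Unset Printing Implicit Defensive.
Import Order.TTheory GRing.Theory Num.Theory.
Import numFieldNormedType.Exports.
Local Open Scope classical_set_scope.
Local Open Scope ring_scope.

Section Defs.
Variable R : realType.

Definition leb := (@lebesgue_measure R).

Definition I01 : set R := `[0%R, 1%R].

Definition frac (a : R) : R := a - (Num.floor a)%:~R.

Definition K (x y : R) : R :=
  if (0 < x) && (0 < y) then 2^-1 - frac ((x * y)^-1) else 0.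

Definition L2 (f : R -> R) : Prop :=
  measurable_fun I01 f /\ leb.-integrable I01 (fun x => ((f x) ^+ 2)%:E).

Definition inner (f g : R -> R) : R := \int[leb]_(x in I01) (f x * g x).

Definition l2norm (f : R -> R) : R := Num.sqrt (inner f f).

Definition eigenfun (phi : R -> R) (lam : R) : Prop :=
  L2 phi /\ 0 < l2norm phi /\
  forall x, I01 x -> phi x = lam * \int[leb]_(y in I01) (K x y * phi y).

(* phi_0, phi_1, ... (paper: phi_1, phi_2, ...) is a maximal orthonormal
   system of eigenfunctions of K, phi_j with nonzero eigenvalue lam_j,
   numbered as in the paper. *)
Definition eigen_system (phi : nat -> R -> R) (lam : nat -> R) : Prop :=
  (forall j, lam j != 0 /\ eigenfun (phi j) (lam j)) /\
  (forall i j, inner (phi i) (phi j) = (i == j)%:R) /\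
  (forall psi mu, eigenfun psi mu -> ~ (forall j, inner psi (phi j) = 0)) /\
  0 < `|lam 0%N| /\
  (forall j, `|lam j| <= `|lam j.+1|) /\
  (forall j, `|lam j| = `|lam j.+1| -> lam j.+1 <= lam j).

Definition QofPhi (phi : R -> R) (y : R) : R :=
  if `[< (0 < y < 1) /\ derivable phi y 1 >] then y * derive1 phi y else 0.

Definition PofQ (phi : R -> R) (lam : R) (x : R) : R :=
  - lam * \int[leb]_(y in I01) (K x y * QofPhi phi y).

End Defs.

(* Main.v *)
(* Write (K f)(x) for the integral of K(x,y) f(y) over [0,1].

   Regularity of an eigenfunction phi.  For fixed x, K(x,.) has small integrals
   over intervals, which together with a modulus of continuity of phi gives
   phi(x) = O(x^(1/5)).  The decay makes phi Lipschitz on [d,1] for every d > 0,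
   and the homogeneity K(c x, y) = K(x, c y) upgrades this to
   |phi(x) - phi(c x)| <= A (1 - c) uniformly in x.  Hence Q(y) = y phi'(y) is
   bounded; it is measurable because derivability can be tested on rational
   difference quotients.

   Hilbert-Schmidt.  Functions K f with f in the unit ball are uniformly bounded
   and equicontinuous at each point of (0,1], so a maximizing sequence for ||K f||
   on the orthogonal complement of the phi_h would produce a further
   eigenfunction; by maximality K vanishes on that complement.  If R_n is the n-th
   remainder of the Fourier expansion of Q, then K R_n converges uniformly, its
   limit is orthogonal to all phi_h, hence null, and being continuous on (0,1] it
   is 0.  Since a_h phi_h = - lam_j <Q, phi_h> K phi_h, the n-th partial sum of
   the series differs from P by lam_j K R_n, and Bessel's inequality for Q and for
   K(x,.) gives absolute convergence. *)
Require Import Defs.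
From HB Require Import structures.
From mathcomp Require Import all_boot all_order all_algebra.
From mathcomp Require Import all_classical all_reals all_analysis.
From mathcomp Require Import measurable_realfun ring lra.
Set Implicit Arguments. Unset Strict Implicit. Unset Printing Implicit Defensive.
Import Order.TTheory GRing.Theory Num.Theory.
Import numFieldNormedType.Exports.
Local Open Scope classical_set_scope.
Local Open Scope ring_scope.

(** * Integrals of bounded measurable functions *)

Section IntervalIntegral.
Variable R : realType.
Implicit Types (a b c x y M : R) (f g : R -> R).

(** Boundedness keeps products integrable over a finite interval. Half-open intervals concatenate
    without overlap, and (0, 1] omits the point where the kernel is set to 0. *)
Definition bm a b f := measurable_fun `]a, b] f /\
  exists M, forall x, a < x <= b -> `|f x| <= M.

Definition itg a b f : R := \int[@leb R]_(y in `]a, b]) f y.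

Lemma in_oc a b x : (`]a, b]%classic x) = (a < x <= b).
Proof. by rewrite /= in_itv. Qed.

Lemma leb_oc a b : a <= b -> fine (@leb R `]a, b]) = b - a.
Proof.
move=> ab; rewrite /leb lebesgue_measure_itv/= lte_fin.
case: ltP => [|ba]//=; have -> : a = b by apply/le_anti; rewrite ab ba.
by rewrite subrr.
Qed.

Lemma leb_oc_lty a b : (@leb R `]a, b] < +oo)%E.
Proof. by rewrite /leb lebesgue_measure_itv/=; case: ifP; rewrite ?ltry. Qed.

Lemma bm_integrable a b f : bm a b f -> (@leb R).-integrable `]a, b] (EFin \o f).
Proof.
move=> [mf [M fM]]; apply: measurable_bounded_integrable => //.
  exact: leb_oc_lty.
exists M; split; first exact: num_real.
by move=> N MN x /=; rewrite in_itv/= => xab; rewrite (le_trans (fM _ xab))// ltW.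
Qed.

Lemma bmS a b c d f : a <= c -> d <= b -> bm a b f -> bm c d f.
Proof.
move=> ac db [mf [M fM]]; split.
  apply: measurable_funS mf => // x /=; rewrite !in_itv/= => /andP[cx xd].
  by rewrite (le_lt_trans ac cx) (le_trans xd db).
by exists M => x /andP[cx xd]; apply: fM; rewrite (le_lt_trans ac cx) (le_trans xd db).
Qed.

Lemma eq_bm a b f g : (forall x, a < x <= b -> f x = g x) -> bm a b f -> bm a b g.
Proof.
move=> fg [mf [M fM]]; split.
  apply: eq_measurable_fun mf => x; rewrite inE/= in_itv/=; exact: fg.
by exists M => x xab; rewrite -fg// fM.
Qed.

Lemma bm_cst a b c : bm a b (fun=> c).
Proof. by split; [exact: measurable_cst|exists `|c|]. Qed.

Lemma bm_id a b : bm a b id.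
Proof.
split; first exact: measurable_id.
exists (`|a| + `|b|) => x /= xab; rewrite ler_norml.
have := ler_norm b; have := lerNnormlW (lexx `|a|).
have := normr_ge0 a; have := normr_ge0 b; lra.
Qed.

Lemma bmD a b f g : bm a b f -> bm a b g -> bm a b (fun x => f x + g x).
Proof.
move=> [mf [M fM]] [mg [N gN]]; split; first exact: measurable_funD.
exists (M + N) => x xab; rewrite (le_trans (ler_normD _ _))// lerD ?fM ?gN//.
Qed.

Lemma bmM a b f g : bm a b f -> bm a b g -> bm a b (fun x => f x * g x).
Proof.
move=> [mf [M fM]] [mg [N gN]]; split; first exact: measurable_funM.
by exists (M * N) => x xab; rewrite normrM ler_pM ?fM ?gN.
Qed.

Lemma bmN a b f : bm a b f -> bm a b (fun x => - f x).
Proof.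
move=> [mf [M fM]]; split; first exact: measurable_funN.
by exists M => x xab; rewrite normrN fM.
Qed.

Lemma bmB a b f g : bm a b f -> bm a b g -> bm a b (fun x => f x - g x).
Proof. by move=> bf bg; apply: bmD => //; apply: bmN. Qed.

Lemma bm_norm a b f : bm a b f -> bm a b (fun x => `|f x|).
Proof.
move=> [mf [M fM]]; split; first exact: measurableT_comp.
by exists M => x xab; rewrite normr_id fM.
Qed.

Lemma bm_sum a b (F : nat -> R -> R) n : (forall h, bm a b (F h)) ->
  bm a b (fun x => \sum_(h < n) F h x).
Proof.
move=> bF; elim: n => [|n ih].
  by apply: (eq_bm _ (bm_cst a b 0)) => x _; rewrite big_ord0.
by apply: (eq_bm _ (bmD ih (bF n))) => x _; rewrite big_ord_recr.
Qed.

Lemma bm_cvg a b (F : nat -> R -> R) f M : (forall n, bm a b (F n)) ->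
  (forall n x, a < x <= b -> `|F n x| <= M) ->
  (forall x, a < x <= b -> F ^~ x @ \oo --> f x) -> bm a b f.
Proof.
move=> bF FM Ff; split.
  apply: (@measurable_fun_cvg _ _ _ _ F) => [n|x]; first by case: (bF n).
  by rewrite in_oc; exact: Ff.
exists M => x xab; have cn : (fun n => `|F n x|) @ \oo --> `|f x| by apply: cvg_norm; exact: Ff.
rewrite -(cvg_lim _ cn)//; apply: limr_le; first exact: cvgP cn.
by apply: nearW => n; exact: FM.
Qed.

Lemma eq_itg a b f g : (forall x, a < x <= b -> f x = g x) -> itg a b f = itg a b g.
Proof. by move=> fg; apply: eq_Rintegral => x; rewrite inE in_oc; exact: fg. Qed.

Lemma itgD a b f g : bm a b f -> bm a b g ->
  itg a b (fun x => f x + g x) = itg a b f + itg a b g.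
Proof. by move=> bf bg; rewrite /itg RintegralD//; exact: bm_integrable. Qed.

Lemma itgB a b f g : bm a b f -> bm a b g ->
  itg a b (fun x => f x - g x) = itg a b f - itg a b g.
Proof. by move=> bf bg; rewrite /itg RintegralB//; exact: bm_integrable. Qed.

Lemma itgZ a b f c : bm a b f -> itg a b (fun x => c * f x) = c * itg a b f.
Proof. by move=> bf; rewrite /itg RintegralZl//; exact: bm_integrable. Qed.

Lemma itg_sum a b (F : nat -> R -> R) n : (forall h, bm a b (F h)) ->
  itg a b (fun x => \sum_(h < n) F h x) = \sum_(h < n) itg a b (F h).
Proof.
move=> bF; elim: n => [|n ih].
  rewrite big_ord0 (@eq_itg _ _ _ (fun x => 0 * 0)).
    by rewrite itgZ ?mul0r//; exact: bm_cst.
  by move=> x _; rewrite big_ord0 mul0r.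
rewrite big_ord_recr/= -ih -itgD//; last exact: bm_sum.
by apply: eq_itg => x _; rewrite big_ord_recr.
Qed.

Lemma itg_cst a b c : a <= b -> itg a b (fun=> c) = c * (b - a).
Proof. by move=> ab; rewrite /itg Rintegral_cst// leb_oc. Qed.

Lemma itg_ge0 a b f : (forall x, a < x <= b -> 0 <= f x) -> 0 <= itg a b f.
Proof. by move=> f0; apply: Rintegral_ge0 => x; rewrite in_oc; exact: f0. Qed.

Lemma itg_le a b f g : bm a b f -> bm a b g ->
  (forall x, a < x <= b -> f x <= g x) -> itg a b f <= itg a b g.
Proof.
move=> bf bg fg; apply: le_Rintegral; [by []|exact: bm_integrable|exact: bm_integrable|].
by move=> x; rewrite in_oc; exact: fg.
Qed.

Lemma itg_norm a b f : bm a b f -> `|itg a b f| <= itg a b (fun x => `|f x|).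
Proof. by move=> bf; apply: le_normr_Rintegral => //; exact: bm_integrable. Qed.

Lemma itg_le_cst a b f M : a <= b -> bm a b f ->
  (forall x, a < x <= b -> f x <= M) -> itg a b f <= M * (b - a).
Proof. by move=> ab bf fM; rewrite -itg_cst//; apply: itg_le => //; exact: bm_cst. Qed.

Lemma itg_bound a b f M : a <= b -> bm a b f ->
  (forall x, a < x <= b -> `|f x| <= M) -> `|itg a b f| <= M * (b - a).
Proof.
move=> ab bf fM; apply: le_trans (itg_norm bf) _.
by apply: itg_le_cst => //; exact: bm_norm.
Qed.

Lemma itg_split a b c f : a <= c -> c <= b -> bm a b f ->
  itg a b f = itg a c f + itg c b f.
Proof.
move=> ac cb bf; have := @Rintegral_itvB R f (BRight a) (BRight b) c.
rewrite !bnd_simp => /(_ (bm_integrable bf) ac cb).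
by rewrite /itg => <-; rewrite addrC subrK.
Qed.

Lemma itg_subset a b c d f : a <= c -> c <= d -> d <= b -> bm a b f ->
  (forall x, a < x <= b -> 0 <= f x) -> itg c d f <= itg a b f.
Proof.
move=> ac cd db bf f0.
rewrite (itg_split ac (le_trans cd db) bf).
rewrite (itg_split cd db (bmS ac (lexx b) bf)).
have : 0 <= itg a c f.
  by apply: itg_ge0 => x /andP[ax xc]; apply: f0; rewrite ax (le_trans xc)// (le_trans cd).
have : 0 <= itg d b f.
  by apply: itg_ge0 => x /andP[dx xb]; apply: f0; rewrite xb (le_lt_trans ac)// (le_lt_trans cd).
lra.
Qed.

(** The image of Lebesgue measure under x -> c x, multiplied by c, gives half-open intervals their
    length, hence is Lebesgue measure. *)
Lemma leb_scale c (A : set R) : 0 < c -> measurable A ->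
  (@leb R) ((fun x : R => c * x) @^-1` A) = (c^-1%:E * @leb R A)%E.
Proof.
move=> c0 mA.
have mc : measurable_fun [set: measurableTypeR R]
    (fun x : measurableTypeR R => c * x : measurableTypeR R).
  exact: mulrl_measurable.
pose mu : {measure set (measurableTypeR R) -> \bar R} :=
  pushforward (@lebesgue_measure R) (fun x : measurableTypeR R => c * x : measurableTypeR R).
have c0' : 0 <= c by exact: ltW.
pose k : {nonneg R} := NngNum c0'.
have := @lebesgue_measure_unique R (mscale k (mu mc)) _ A mA.
rewrite /mscale/= /pushforward/= /leb => ->.
  by rewrite muleA -EFinM mulVf ?gt_eqF// mul1e.
move=> X [[u v]] _ <-.
rewrite /mscale/= /pushforward (_ : _ @^-1` _ = `](u / c), (v / c)]%classic); last first.
  by apply/seteqP; split => x /=; rewrite !in_itv/= ltr_pdivrMr// ler_pdivlMr// mulrC.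
rewrite !lebesgue_measure_itv/= !lte_fin ltr_pM2r ?invr_gt0//.
case: ifP => _; last by rewrite mule0.
by rewrite -EFinB -EFinM -mulrBl mulrCA divff ?gt_eqF// mulr1.
Qed.

Lemma bm_scale a b c f : 0 < c -> bm (c * a) (c * b) f -> bm a b (fun y => f (c * y)).
Proof.
move=> c0 [mf [M fM]]; split; last first.
  by exists M => x xab; apply: fM; rewrite ltr_pM2l// ler_pM2l.
apply: (@measurable_comp _ _ _ _ _ _ `](c * a), (c * b)]%classic f _ ( *%R c)) => //.
by move=> _ [x /= + <-]; rewrite !in_itv/= ltr_pM2l// ler_pM2l.
Qed.

Lemma itg_scale a b c f : 0 < c -> bm (c * a) (c * b) f ->
  itg a b (fun y => f (c * y)) = c^-1 * itg (c * a) (c * b) f.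
Proof.
move=> c0 bf; case: (leP b a) => [ba|ab].
  rewrite /itg !set_itv_ge ?bnd_simp -?leNgt ?ler_pM2l//.
  by rewrite !Rintegral_set0 mulr0.
have ge0_case g : bm (c * a) (c * b) g ->
    (forall x, c * a < x <= c * b -> 0 <= g x) ->
    itg a b (fun y => g (c * y)) = c^-1 * itg (c * a) (c * b) g.
  move=> bg g0.
  have mc : measurable_fun [set: measurableTypeR R]
    (fun x : measurableTypeR R => c * x : measurableTypeR R) by exact: mulrl_measurable.
  have Vc0 : 0 <= c^-1 by rewrite invr_ge0 ltW.
  pose k : {nonneg R} := NngNum Vc0.
  have mg : measurable_fun `](c * a), (c * b)] (EFin \o g).
    by apply/measurable_EFinP; case: bg.
  have gE x : `](c * a), (c * b)]%classic x -> (0 <= (EFin \o g) x)%E.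
    by rewrite in_oc => xab; rewrite lee_fin g0.
  have := @ge0_integral_pushforward _ _ _ _ R _ mc (@lebesgue_measure R) `](c * a), (c * b)]%classic
    (EFin \o g) (measurable_itv _) mg.
  rewrite (_ : _ @^-1` _ = `]a, b]%classic); last first.
    by apply/seteqP; split => x /=; rewrite !in_itv/= ltr_pM2l// ler_pM2l.
  move=> E; rewrite /itg /Rintegral.
  have -> : (\int[@leb R]_(y in `]a, b]%classic) (g (c * y)%R)%:E =
    c^-1%:E * \int[@leb R]_(y in `](c * a)%R, (c * b)%R]%classic) (g y)%:E)%E; last first.
    rewrite fineM//; have := bm_integrable bg => /integrable_fin_num; exact.
  have /E <- : {in `](c * a), (c * b)]%classic, forall y, (0 <= (EFin \o g) y)%E}.
    by move=> x; rewrite inE; exact: gE.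
  have := @ge0_integral_mscale _ _ R (@lebesgue_measure R) _ (measurable_itv `](c * a), (c * b)]) k
    (EFin \o g) mg gE.
  move=> /= <-.
  by apply: eq_measure_integral => A mA _; exact: leb_scale.
(* Adding a bound M of |f| reduces to the nonnegative case; the constant contributes M (b - a) to
   both sides. *)
have [_ [M fM]] := bf.
have bfM : bm (c * a) (c * b) (fun x => f x + M) by apply: bmD => //; exact: bm_cst.
have bfc := bm_scale c0 bf.
have := @ge0_case _ bfM; rewrite itgD//; last exact: bm_cst.
rewrite itgD//; last exact: bm_cst.
rewrite !itg_cst ?ler_pM2l//; do ?exact: ltW.
have {}fM : forall x, c * a < x <= c * b -> 0 <= f x + M.
  by move=> x /fM; rewrite ler_norml; lra.
move=> /(_ fM) E; apply: (addIr (M * (b - a))); rewrite E mulrDr; congr (_ + _).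
by field; rewrite gt_eqF.
Qed.

End IntervalIntegral.

(** * The kernel *)

Section Kernel.
Variable R : realType.
Implicit Types (a b c x y t M : R) (f g : R -> R).

Definition invfloor t : R := (Num.floor t^-1)%:~R.

(** The kernel depends on t = x y only, and this is its profile; writing {1/t} as 1/t minus its
    floor separates two monotone parts. *)
Definition kap t : R := if 0 < t then 2^-1 - (t^-1 - invfloor t) else 0.

Lemma K_kap x y : 0 <= x -> 0 <= y -> K x y = kap (x * y).
Proof.
move=> x0 y0; rewrite /K /kap /frac /invfloor.
case: (ltP 0 x) => [xp|]/=.
  by rewrite pmulr_rgt0//; case: (ltP 0 y).
move=> x0'; have -> : x = 0 by apply/le_anti; rewrite x0'.
by rewrite mul0r ltxx.
Qed.

Lemma invfloor_itv t : invfloor t <= t^-1 < invfloor t + 1.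
Proof. by have := floor_itv t^-1; rewrite intrD. Qed.

Lemma invfloorW s t : 0 < s -> s <= t -> invfloor t <= invfloor s.
Proof.
by move=> s0 st; rewrite /invfloor ler_int le_floor// lef_pV2// posrE// (lt_le_trans s0).
Qed.

Lemma invfloor_ge0 t : 0 < t -> 0 <= invfloor t.
Proof. by move=> t0; rewrite /invfloor ler0z floor_ge0 invr_ge0 ltW. Qed.

Lemma kap_bound t : `|kap t| <= 2^-1.
Proof.
rewrite /kap; case: ifP => _; last by rewrite normr0 invr_ge0.
by have := invfloor_itv t; rewrite ler_norml; lra.
Qed.

Lemma measurable_inv_gt0 : measurable_fun (`]0%R, +oo[%classic : set R) (@GRing.inv R).
Proof.
apply: open_continuous_measurable_fun; first exact: interval_open.
move=> x; rewrite inE/= in_itv/= andbT => x0.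
by apply: inv_continuous; rewrite gt_eqF.
Qed.

Lemma measurable_invfloor : measurable_fun (`]0%R, +oo[%classic : set R) invfloor.
Proof.
apply: (@measurable_comp _ _ _ _ _ _ setT (fun s : R => (Num.floor s)%:~R : R)) => //.
  apply: nondecreasing_measurable => // s t st; by rewrite ler_int le_floor.
exact: measurable_inv_gt0.
Qed.

Lemma measurable_kap : measurable_fun [set: R] kap.
Proof.
have -> : [set: R] = `]-oo, 0] `|` `]0, +oo[.
  apply/seteqP; split => // x _ /=; rewrite !in_itv/= andbT.
  by case: (leP x 0); [left|right].
apply/measurable_funU => //; split.
  apply: (eq_measurable_fun (fun=> 0 : R)) => [x|]; last exact: measurable_cst.
  by rewrite inE/= in_itv/= /kap leNgt => /negbTE ->.
apply: (eq_measurable_fun (fun t => 2^-1 - (t^-1 - invfloor t))) => [x|].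
  by rewrite inE/= in_itv/= andbT /kap => ->.
apply: measurable_funB; first exact: measurable_cst.
by apply: measurable_funB; [exact: measurable_inv_gt0|exact: measurable_invfloor].
Qed.

Lemma bm_kap a b x : bm a b (fun y => kap (x * y)).
Proof.
split; last by exists 2^-1 => y _; exact: kap_bound.
apply: measurable_funTS; apply: (measurableT_comp measurable_kap).
exact: mulrl_measurable.
Qed.

Lemma bm_invfloor a b : 0 < a -> bm a b invfloor.
Proof.
move=> a0; split.
  apply: measurable_funS measurable_invfloor => // x /=.
  by rewrite !in_itv/= andbT => /andP[ax _]; exact: lt_trans ax.
exists a^-1 => x /andP[ax _]; have x0 := lt_trans a0 ax.
rewrite ger0_norm ?invfloor_ge0//.
have /andP[fx _] := invfloor_itv x; rewrite (le_trans fx)//.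
by rewrite lef_pV2 ?posrE// ltW.
Qed.

Lemma bm_invfloorM a b x : 0 < a -> 0 < x -> bm a b (fun y => invfloor (x * y)).
Proof.
by move=> a0 x0; apply: bm_scale => //; apply: bm_invfloor; rewrite mulr_gt0.
Qed.

Lemma itg_invfloor_le a b : 0 < a -> a <= b -> itg a b invfloor <= a^-1 * (b - a).
Proof.
move=> a0 ab; apply: itg_le_cst => //; first exact: bm_invfloor.
move=> x /andP[ax _]; have /andP[fx _] := invfloor_itv x; rewrite (le_trans fx)//.
by have x0 := lt_trans a0 ax; rewrite lef_pV2 ?posrE// ltW.
Qed.

(* Scaling turns both integrals into integrals of the same function, which
   differ by boundary terms only. *)
Lemma itg_invfloor_diff a b x x' : 0 < a -> a <= b -> 0 < x -> x <= x' ->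
  itg a b (fun y => invfloor (x * y) - invfloor (x' * y)) <=
  (x^-1 - x'^-1) * (x' / x + (b - a) / a).
Proof.
move=> a0 ab x0 xx'; have x'0 := lt_le_trans x0 xx'.
have [xa0 x'a0] := (mulr_gt0 x0 a0, mulr_gt0 x'0 a0).
rewrite itgB; do ?exact: bm_invfloorM.
rewrite !itg_scale//; do ?exact: bm_invfloor.
have xab : x * a <= x * b by rewrite ler_pM2l.
have x'ab : x' * a <= x' * b by rewrite ler_pM2l.
have xx'a : x * a <= x' * a by rewrite ler_pM2r.
have xx'b : x * b <= x' * b by rewrite ler_pM2r// (lt_le_trans a0).
have bf : bm (x * a) (x' * b) invfloor by exact: bm_invfloor.
have := itg_split xab xx'b bf; rewrite (itg_split xx'a x'ab bf) => E.
have h1 : 0 <= itg (x * b) (x' * b) invfloor.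
  by apply: itg_ge0 => t /andP[+ _] => /(lt_trans (lt_le_trans xa0 xab)); exact: invfloor_ge0.
have h2 := itg_invfloor_le xa0 xx'a.
have h3 := itg_invfloor_le x'a0 x'ab.
have V0 : 0 <= x^-1 - x'^-1 by rewrite subr_ge0 lef_pV2// posrE.
apply: (@le_trans _ _ (x^-1 * ((x * a)^-1 * (x' * a - x * a)) +
  (x^-1 - x'^-1) * ((x' * a)^-1 * (x' * b - x' * a)))).
  have h3' := ler_wpM2l V0 h3.
  have Vx : 0 <= x^-1 by rewrite invr_ge0 ltW.
  have h2' := ler_wpM2l Vx h2.
  have h1' := mulr_ge0 Vx h1.
  have E' := congr1 (fun z => x^-1 * z) E; move: E'; rewrite /= !mulrDr.
  lra.
rewrite le_eqVlt; apply/orP; left; apply/eqP.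
by field; rewrite !gt_eqF.
Qed.

(** [t^-1] and [invfloor t] are both nonincreasing for t > 0, so their increments have a known sign
    and the bound can be integrated although the kernel jumps. *)
Lemma kap_diff_le x x' y : 0 < x -> x <= x' -> 0 < y ->
  `|kap (x * y) - kap (x' * y)| <=
  (x^-1 - x'^-1) * y^-1 + (invfloor (x * y) - invfloor (x' * y)).
Proof.
move=> x0 xx' y0; have x'0 := lt_le_trans x0 xx'.
rewrite /kap !mulr_gt0//.
have h1 : 0 <= (x^-1 - x'^-1) * y^-1.
  by apply: mulr_ge0; [rewrite subr_ge0 lef_pV2// posrE|rewrite invr_ge0 ltW].
have h2 : invfloor (x' * y) <= invfloor (x * y).
  by apply: invfloorW; rewrite ?mulr_gt0// ler_pM2r.
rewrite !invfM mulrBl in h1 *; rewrite ler_norml; lra.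
Qed.

(** Each monotone part contributes (b - a) / a, and x' / x is the boundary term of the scaling. The
    interval enters only through b / a, so blocks of equal ratio get equal bounds. *)
Lemma itg_kap_diff a b x x' : 0 < a -> a <= b -> 0 < x -> x <= x' ->
  itg a b (fun y => `|kap (x * y) - kap (x' * y)|) <=
  (x^-1 - x'^-1) * (x' / x + 2 * ((b - a) / a)).
Proof.
move=> a0 ab x0 xx'; have x'0 := lt_le_trans x0 xx'.
have V0 : 0 <= x^-1 - x'^-1 by rewrite subr_ge0 lef_pV2// posrE.
have bF : bm a b (fun y => invfloor (x * y) - invfloor (x' * y)).
  by apply: bmB; apply: bm_invfloorM.
apply: (@le_trans _ _ (itg a b (fun y => (x^-1 - x'^-1) * a^-1 +
  (invfloor (x * y) - invfloor (x' * y))))).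
  apply: itg_le.
  - by apply: bm_norm; apply: bmB; exact: bm_kap.
  - by apply: bmD => //; exact: bm_cst.
  - move=> y /andP[ay _]; have y0 := lt_trans a0 ay.
    apply: le_trans (kap_diff_le x0 xx' y0) _.
    by rewrite lerD2r ler_wpM2l// lef_pV2 ?posrE// ltW.
rewrite itgD//; last exact: bm_cst.
rewrite itg_cst//; have := itg_invfloor_diff a0 ab x0 xx'.
by lra.
Qed.

End Kernel.

(** * Cancellation in integrals of the kernel *)

Section Cancellation.
Variable R : realType.
Implicit Types (a b c x y t p q r N : R) (f g : R -> R).

Lemma itg_affine p q a b : p <= q ->
  itg p q (fun t => a * t + b) = a * (q ^+ 2 - p ^+ 2) / 2 + b * (q - p).
Proof.
rewrite le_eqVlt => /orP[/eqP ->|pq].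
  rewrite !subrr mulr0 mul0r mulr0 addr0 /itg set_itv_ge ?bnd_simp ?ltxx//.
  exact: Rintegral_set0.
have bm_aff : bm p q (fun t => a * t + b).
  by apply: bmD; [apply: bmM; [exact: bm_cst|exact: bm_id]|exact: bm_cst].
rewrite /itg Rintegral_itv_obnd_cbnd; last exact: bm_integrable.
pose F t : R := a / 2 * t ^+ 2 + b * t.
have dF t : is_derive t 1 F (a * t + b).
  rewrite /F; apply: is_derive_eq; rewrite /GRing.scale/= !mulr1; lra.
suff FTC : (\int[@lebesgue_measure R]_(x in `[p, q]%classic) (a * x + b)%R%:E = (F q)%:E - (F p)%:E)%E.
  transitivity (fine ((F q)%:E - (F p)%:E)%E); first by congr fine; exact: FTC.
  by rewrite -EFinB /= /F; lra.
apply: (@continuous_FTC2 R (fun t => a * t + b) F p q pq).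
- apply: continuous_in_subspaceT => t _.
  apply: cvgD; last exact: cvg_cst.
  by apply: cvgM; [exact: cvg_cst|exact: cvg_id].
- have cF t : {for t, continuous F}.
    by apply: differentiable_continuous; apply/derivable1_diffP; apply: ex_derive.
  split.
  + by move=> t _; apply: ex_derive.
  + by apply: cvg_at_right_filter; exact: cF.
  + by apply: cvg_at_left_filter; exact: cF.
- by move=> t _; rewrite derive1E; exact: derive_val.
Qed.

(* With s = {1/t} this is t^2 s (s - 1) / 2, a continuous function whose
   derivative is kap t up to O(t); on each interval [1/(n+1), 1/n] it is a
   quadratic polynomial in t. *)
Definition kap_primitive t : R :=
  (1 - invfloor t * t) * (1 - (invfloor t + 1) * t) / 2.

Lemma invfloor_cell (n : nat) t : 0 < t -> n%:R * t <= 1 -> 1 < (n%:R + 1) * t ->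
  invfloor t = n%:R.
Proof.
move=> t0 h1 h2; rewrite /invfloor (@floor_def _ _ n)//.
rewrite intrD/= -[_%:~R]/(n%:R); apply/andP; split.
  by rewrite -(ler_pM2r t0) mulVf// gt_eqF.
by rewrite -(ltr_pM2r t0) mulVf// gt_eqF.
Qed.

(** At the left endpoint t = 1/(n+1) the floor is already n+1, but both expressions contain the
    vanishing factor 1 - (n+1) t. This is the continuity of [kap_primitive]. *)
Lemma kap_primitive_cell (n : nat) t : 0 < t ->
  n%:R * t <= 1 -> 1 <= (n%:R + 1) * t ->
  kap_primitive t = (1 - n%:R * t) * (1 - (n%:R + 1) * t) / 2.
Proof.
move=> t0 h1; rewrite le_eqVlt => /orP[/eqP h2|h2]; last first.
  by rewrite /kap_primitive (invfloor_cell t0 h1 h2).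
rewrite /kap_primitive (@invfloor_cell n.+1 t)//.
- by rewrite -natr1 -h2 !subrr !(mul0r, mulr0).
- by rewrite -natr1 -h2.
- by rewrite -natr1 mulrDl -h2 mul1r ltrDl.
Qed.

(** The factors 1 - n t and (n+1) t - 1 are nonnegative with sum t, so their product is at most t^2
    / 4. *)
Lemma kap_primitive_itv t : 0 < t -> - (t ^+ 2 / 8) <= kap_primitive t <= 0.
Proof.
move=> t0; rewrite /kap_primitive; have /andP[h1 h2] := invfloor_itv t.
set n := invfloor t in h1 h2 *.
have A0 : 0 <= 1 - n * t by rewrite subr_ge0 -(@mulVf _ t) ?gt_eqF// ler_pM2r.
have B0 : 0 <= (n + 1) * t - 1.
  by rewrite subr_ge0 -[X in X <= _](@mulVf _ t) ?gt_eqF// ler_pM2r// ltW.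
have := mulr_ge0 A0 B0.
have := sqr_ge0 ((1 - n * t) - ((n + 1) * t - 1)); rewrite !expr2.
by move=> h3 h4; apply/andP; split; nra.
Qed.

Lemma itg_kap_cell (n : nat) p q : 0 < p -> p <= q ->
  n%:R * q <= 1 -> 1 <= (n%:R + 1) * p ->
  0 <= itg p q (@kap R) - (kap_primitive q - kap_primitive p) <= q / 4 * (q - p).
Proof.
move=> p0 pq hq hp; have q0 := lt_le_trans p0 pq.
set N : R := n%:R in hq hp *; have N0 : 0 <= N by exact: ler0n.
rewrite (@kap_primitive_cell n q)//; last by rewrite (le_trans hp)// ler_pM2l// -/N; lra.
rewrite (@kap_primitive_cell n p)//; last by rewrite (le_trans _ hq)// ler_wpM2l.
rewrite -/N.
have bk : bm p q (@kap R).
  by apply: (eq_bm _ (@bm_kap R p q 1)) => y _; rewrite mul1r.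
have bl : bm p q (fun t => N * (N + 1) * t - (2 * N + 1) / 2).
  by apply: bmB; [apply: bmM; [exact: bm_cst|exact: bm_id]|exact: bm_cst].
have E := @itg_affine p q (N * (N + 1)) (- ((2 * N + 1) / 2)) pq.
(* The affine integrand is the derivative of the quadratic polynomial on this cell. *)
have -> : (1 - N * q) * (1 - (N + 1) * q) / 2 - (1 - N * p) * (1 - (N + 1) * p) / 2
  = itg p q (fun t => N * (N + 1) * t - (2 * N + 1) / 2) by rewrite E; lra.
rewrite -itgB//.
have key t : p < t <= q ->
    0 <= kap t - (N * (N + 1) * t - (2 * N + 1) / 2) <= q / 4.
  move=> /andP[pt tq]; have t0 := lt_trans p0 pt.
  have h1 : N * t <= 1 by rewrite (le_trans _ hq)// ler_wpM2l.
  have h2 : 1 < (N + 1) * t by rewrite (le_lt_trans hp)// ltr_pM2l//; lra.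
  rewrite /kap t0 (invfloor_cell t0 h1 h2) -/N.
  (* Again two nonnegative factors with sum t: the quotient of their product by t lies between 0 and
     t / 4. *)
  have -> : 2^-1 - (t^-1 - N) - (N * (N + 1) * t - (2 * N + 1) / 2) =
    (1 - N * t) * ((N + 1) * t - 1) * t^-1 by field; rewrite gt_eqF.
  have A0 : 0 <= 1 - N * t by rewrite subr_ge0.
  have B0 : 0 <= (N + 1) * t - 1 by rewrite subr_ge0 ltW.
  have V0 : 0 <= t^-1 by rewrite invr_ge0 ltW.
  apply/andP; split; first by rewrite !mulr_ge0.
  apply: (@le_trans _ _ (t / 4)); last by rewrite ler_pM2r.
  rewrite ler_pdivrMr//.
  have := sqr_ge0 ((1 - N * t) - ((N + 1) * t - 1)); rewrite expr2; lra.
apply/andP; split.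
  by apply: itg_ge0 => t /key /andP[].
by apply: itg_le_cst => //; [exact: bmB|move=> t /key /andP[]].
Qed.

(** Summation over cells, by induction on a bound for the number of cells; the error bounds add up
    because r <= q gives r (r - p) + q (q - r) <= q (q - p). *)
Lemma itg_kap_primitive p q : 0 < p -> p <= q -> q <= 1 ->
  0 <= itg p q (@kap R) - (kap_primitive q - kap_primitive p) <= q / 4 * (q - p).
Proof.
move=> p0 pq q1.
have [m hm] : exists m : nat, 1 <= (m%:R + 1) * p.
  have pV0 : 0 <= p^-1 by rewrite invr_ge0 ltW.
  exists (Num.bound p^-1); have := archi_boundP pV0.
  rewrite -(ltr_pM2r p0) mulVf ?gt_eqF// mulrDl mul1r; lra.
elim: m p q p0 pq q1 hm => [|m ih] p q p0 pq q1 hm.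
  have p1 : p = 1 by apply/le_anti; rewrite (le_trans pq q1)/=; lra.
  have -> : q = 1 by apply/le_anti; rewrite q1 -p1.
  by rewrite p1 /itg set_itv_ge ?bnd_simp ?ltxx// Rintegral_set0; lra.
case: (leP 1 ((m%:R + 1) * p)) => [hp|hp]; first exact: ih.
case: (leP (m.+1%:R * q) 1) => [hq|hq]; first exact: (@itg_kap_cell m.+1).
(* Here p < r < q: the piece from p to r lies in a single cell, and the piece from r to q is covered
   by the induction hypothesis. *)
pose r : R := m.+1%:R^-1.
have m0 : 0 < m.+1%:R :> R by rewrite ltr0n.
have r0 : 0 < r by rewrite invr_gt0.
have pr : p <= r by rewrite /r -[leRHS]mul1r ler_pdivlMr// mulrC -natr1 ltW.
have rq : r <= q by rewrite /r -[leLHS]mul1r ler_pdivrMr// mulrC ltW.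
have mr : m.+1%:R * r = 1 by rewrite divff// gt_eqF.
have /andP[a1 a2] : 0 <= itg p r (@kap R) - (kap_primitive r - kap_primitive p) <= r / 4 * (r - p).
  by apply: (@itg_kap_cell m.+1) => //; rewrite mr.
have /andP[b1 b2] : 0 <= itg r q (@kap R) - (kap_primitive q - kap_primitive r) <= q / 4 * (q - r).
  by apply: ih => //; rewrite natr1 mr.
have bk : bm p q (@kap R).
  by apply: (eq_bm _ (@bm_kap R p q 1)) => y _; rewrite mul1r.
rewrite (itg_split pr rq bk); apply/andP; split; first lra.
have : 0 <= (q - r) * (r - p) by rewrite mulr_ge0 ?subr_ge0.
nra.
Qed.

(** The substitution t = x y gives 1/x times an integral of [kap] inside (0, x], where the values of
    the primitive and the error are O(x^2). The trivial bound (b - a) / 2 has no decay in x. *)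
Lemma itg_kapM_bound a b x : 0 < a -> a <= b -> b <= 1 -> 0 < x -> x <= 1 ->
  `|itg a b (fun y => kap (x * y))| <= x.
Proof.
move=> a0 ab b1 x0 x1.
have bk : bm (x * a) (x * b) (@kap R).
  by apply: (eq_bm _ (@bm_kap R _ _ 1)) => y _; rewrite mul1r.
rewrite itg_scale// normrM gtr0_norm ?invr_gt0// mulrC ler_pdivrMr//.
have xa0 : 0 < x * a by rewrite mulr_gt0.
have xab : x * a <= x * b by rewrite ler_pM2l.
have xb0 := lt_le_trans xa0 xab.
have xbx : x * b <= x by rewrite ler_piMr// ltW.
have /andP[h1 h2] := itg_kap_primitive xa0 xab (le_trans xbx x1).
have /andP[h3 h4] := kap_primitive_itv xa0.
have /andP[h5 h6] := kap_primitive_itv xb0.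
rewrite ler_norml; apply/andP; split; nra.
Qed.

End Cancellation.

(** * The integral operator *)

Section Operator.
Variable R : realType.
Implicit Types (a b c x y t M : R) (f g : R -> R).

Definition Kop f x : R := itg 0 1 (fun y => kap (x * y) * f y).

Definition ip f g : R := itg 0 1 (fun x => f x * g x).

Lemma bm_kapM f x : bm 0 1 f -> bm 0 1 (fun y => kap (x * y) * f y).
Proof. by move=> bf; apply: bmM => //; exact: bm_kap. Qed.

Lemma ipC f g : ip f g = ip g f.
Proof. by apply: eq_itg => x _; rewrite mulrC. Qed.

Lemma eq_ipl f f' g : (forall x, 0 < x <= 1 -> f x = f' x) -> ip f g = ip f' g.
Proof. by move=> ff'; apply: eq_itg => x x01; rewrite ff'. Qed.

Lemma ipDl f f' g : bm 0 1 f -> bm 0 1 f' -> bm 0 1 g ->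
  ip (fun x => f x + f' x) g = ip f g + ip f' g.
Proof.
move=> bf bf' bg; rewrite /ip -itgD; do ?exact: bmM.
by apply: eq_itg => x _; rewrite mulrDl.
Qed.

Lemma ipZl f g c : bm 0 1 f -> bm 0 1 g -> ip (fun x => c * f x) g = c * ip f g.
Proof.
move=> bf bg; rewrite /ip -itgZ; last exact: bmM.
by apply: eq_itg => x _; rewrite mulrA.
Qed.

Lemma bmZ a b c f : bm a b f -> bm a b (fun x => c * f x).
Proof. by move=> bf; apply: bmM => //; exact: bm_cst. Qed.

Lemma ipBl f f' g : bm 0 1 f -> bm 0 1 f' -> bm 0 1 g ->
  ip (fun x => f x - f' x) g = ip f g - ip f' g.
Proof.
move=> bf bf' bg; rewrite /ip -itgB; do ?exact: bmM.
by apply: eq_itg => x _; rewrite mulrBl.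
Qed.

Lemma ip_suml (F : nat -> R -> R) g n : (forall h, bm 0 1 (F h)) -> bm 0 1 g ->
  ip (fun x => \sum_(h < n) F h x) g = \sum_(h < n) ip (F h) g.
Proof.
move=> bF bg; rewrite /ip -(@itg_sum R 0 1 (fun h x => F h x * g x)); last by move=> h; exact: bmM.
by apply: eq_itg => x _; rewrite mulr_suml.
Qed.

Lemma ip_ge0 f : 0 <= ip f f.
Proof. by apply: itg_ge0 => x _; rewrite -expr2 sqr_ge0. Qed.

Lemma ip_lincomb f g c d : bm 0 1 f -> bm 0 1 g ->
  ip (fun x => c * f x + d * g x) (fun x => c * f x + d * g x) =
  c ^+ 2 * ip f f + 2 * c * d * ip f g + d ^+ 2 * ip g g.
Proof.
move=> bf bg.
have bcd : bm 0 1 (fun x => c * f x + d * g x) by apply: bmD; exact: bmZ.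
rewrite ipDl; do ?exact: bmZ; rewrite // !ipZl// (ipC f (fun _ => _)) (ipC g (fun _ => _)).
rewrite !ipDl; do ?exact: bmZ; rewrite // !ipZl// (ipC g f); ring.
Qed.

Lemma cauchy_schwarz f g : bm 0 1 f -> bm 0 1 g -> ip f g ^+ 2 <= ip f f * ip g g.
Proof.
move=> bf bg; have f0 := ip_ge0 f; have g0 := ip_ge0 g.
have H c d := ip_ge0 (fun x => c * f x + d * g x).
case: (eqVneq (ip g g) 0) => [gg|gg].
  (* With ||g|| = 0 this combination has squared norm - <f,g>^2 (||f||^2 + 2), which forces <f,g> =
     0. *)
  have h1 := H (ip f g) (- (ip f f + 1)).
  rewrite ip_lincomb// gg in h1; rewrite gg mulr0.
  rewrite leNgt; apply/negP => fg.
  have : 0 < (ip f f + 2) * ip f g ^+ 2 by rewrite mulr_gt0//; lra.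
  rewrite !expr2 in h1 *; nra.
have h1 := H (ip g g) (- ip f g).
rewrite ip_lincomb// in h1.
have {}g0 : 0 < ip g g by rewrite lt_neqAle eq_sym gg.
rewrite -(ler_pM2l g0); rewrite !expr2 in h1 *; nra.
Qed.

Lemma KopD f g x : bm 0 1 f -> bm 0 1 g ->
  Kop (fun y => f y + g y) x = Kop f x + Kop g x.
Proof.
move=> bf bg; rewrite /Kop -itgD; do ?exact: bm_kapM.
by apply: eq_itg => y _; rewrite mulrDr.
Qed.

Lemma KopB f g x : bm 0 1 f -> bm 0 1 g ->
  Kop (fun y => f y - g y) x = Kop f x - Kop g x.
Proof.
move=> bf bg; rewrite /Kop -itgB; do ?exact: bm_kapM.
by apply: eq_itg => y _; rewrite mulrBr.
Qed.

Lemma KopZ f c x : bm 0 1 f -> Kop (fun y => c * f y) x = c * Kop f x.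
Proof.
move=> bf; rewrite /Kop -itgZ; last exact: bm_kapM.
by apply: eq_itg => y _; rewrite mulrCA.
Qed.

Lemma Kop_sum (F : nat -> R -> R) n x : (forall h, bm 0 1 (F h)) ->
  Kop (fun y => \sum_(h < n) F h y) x = \sum_(h < n) Kop (F h) x.
Proof.
move=> bF; rewrite /Kop -(@itg_sum R 0 1 (fun h y => kap (x * y) * F h y)); last first.
  by move=> h; exact: bm_kapM.
by apply: eq_itg => y _; rewrite mulr_sumr.
Qed.

Lemma eq_Kop f g x : (forall y, 0 < y <= 1 -> f y = g y) -> Kop f x = Kop g x.
Proof. by move=> fg; apply: eq_itg => y y01; rewrite fg. Qed.

Lemma ip_kap_le x : ip (fun y => kap (x * y)) (fun y => kap (x * y)) <= 4^-1.
Proof.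
rewrite -[4^-1]mulr1 -[X in _ * X](subr0 1); apply: itg_le_cst => //.
  by apply: bmM; exact: bm_kap.
move=> y _; have := kap_bound (x * y); rewrite ler_norml; nra.
Qed.

Lemma Kop_sqr_le f x : bm 0 1 f -> Kop f x ^+ 2 <= 4^-1 * ip f f.
Proof.
move=> bf; have := cauchy_schwarz (bm_kap 0 1 x) bf => /le_trans; apply.
by rewrite ler_wpM2r ?ip_ge0// ip_kap_le.
Qed.

(** Two values of the kernel differ by at most 1, so the squared difference is below its absolute
    value and the L^1 modulus controls the L^2 modulus. *)
Lemma Kop_diff_sqr_le f x x' : bm 0 1 f ->
  (Kop f x - Kop f x') ^+ 2 <=
  itg 0 1 (fun y => `|kap (x * y) - kap (x' * y)|) * ip f f.
Proof.
move=> bf; have bd : bm 0 1 (fun y => kap (x * y) - kap (x' * y)).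
  by apply: bmB; exact: bm_kap.
have -> : Kop f x - Kop f x' = ip (fun y => kap (x * y) - kap (x' * y)) f.
  by rewrite ipBl//; exact: bm_kap.
apply: le_trans (cauchy_schwarz bd bf) _; rewrite ler_wpM2r ?ip_ge0//.
apply: itg_le; [exact: bmM|exact: bm_norm|move=> y _].
have := kap_bound (x * y); have := kap_bound (x' * y).
set u := kap _ - kap _ => h1 h2.
have u1 : `|u| <= 1.
  by rewrite (le_trans (ler_normB _ _))//; lra.
by rewrite -expr2 -real_normK ?num_real// expr2 ler_piMr.
Qed.

Local Notation box := (`]0%R, 1%R]%classic : set R).

(** Zero extension of f and g puts the integrand on the whole plane for Fubini's theorem; the factor
    f(y) g(x) lets one integrand serve both orders of integration. *)
Let ker2 f g (z : R * R) : \bar R :=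
  (kap (z.1 * z.2) * (f \_ box) z.2 * (g \_ box) z.1)%:E.

Let measurable_ker2 f g : bm 0 1 f -> bm 0 1 g -> measurable_fun setT (ker2 f g).
Proof.
move=> [mf _] [mg _]; apply/measurable_EFinP.
apply: measurable_funM; first apply: measurable_funM.
- apply: (measurableT_comp (@measurable_kap R)); apply: measurable_funM.
    exact: measurable_fst.
  exact: measurable_snd.
- by apply: measurableT_comp; [exact: (measurable_restrictT f (measurable_itv _)).1|exact: measurable_snd].
- by apply: measurableT_comp; [exact: (measurable_restrictT g (measurable_itv _)).1|exact: measurable_fst].
Qed.

Let integrable_ker2 f g : bm 0 1 f -> bm 0 1 g ->
  (@lebesgue_measure R \x @lebesgue_measure R)%E.-integrable setT (ker2 f g).
Proof.
move=> bf bg; have [_ [M fM]] := bf; have [_ [N gN]] := bg.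
have mbox : measurable (box `*` box) by apply: measurableX; exact: measurable_itv.
have E : ker2 f g = ((EFin \o (fun z => fine (ker2 f g z))) \_ (box `*` box)).
  apply/funext => -[x y]; rewrite /ker2/= /patch.
  case: (boolP ((x, y) \in _)) => [//|].
  case: (boolP (y \in box)) => yb; last by rewrite mulr0 mul0r.
  case: (boolP (x \in box)) => xb; last by rewrite mulr0.
  by move/negP; case; move: xb yb; rewrite !inE.
rewrite E; apply/integrable_restrict => //; rewrite setTI.
apply: measurable_bounded_integrable => //.
- apply: (@le_lt_trans _ _ (@leb R box * @leb R box)%E).
    rewrite -(@product_measure1E _ _ _ _ R (@leb R) (@lebesgue_measure R))//.
  by rewrite lte_mul_pinfty ?ge0_fin_numE//; exact: (@leb_oc_lty R 0 1).
- apply: measurable_funTS; have := measurable_ker2 bf bg.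
  by move/measurable_EFinP.
- exists (2^-1 * M * N); split; first exact: num_real.
  move=> c cM [x y] [/= xb yb]; apply: le_trans (ltW cM).
  have hx : 0 < x <= 1 by move: xb; rewrite in_itv.
  have hy : 0 < y <= 1 by move: yb; rewrite in_itv.
  rewrite /patch !mem_set//= normrM ler_pM ?gN//.
  by rewrite normrM ler_pM ?kap_bound ?fM.
Qed.

Let ker2E f g x : bm 0 1 f -> bm 0 1 g ->
  (\int[@lebesgue_measure R]_y ker2 f g (x, y) =
  (Kop f x * (g \_ box) x)%R%:E)%E.
Proof.
move=> bf bg.
transitivity (\int[@leb R]_(y in box) (EFin \o (fun y => kap (x * y) * f y * (g \_ box) x)%R) y)%E.
  rewrite [RHS]integral_mkcond; apply: eq_integral => y _.
  rewrite /ker2 /= [in RHS]/patch; case: ifPn => yb; rewrite [in LHS]/patch.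
    by rewrite yb.
  by rewrite (negbTE yb) mulr0 mul0r.
have bi : bm 0 1 (fun y => kap (x * y) * f y * (g \_ box) x).
  by apply: bmM; [exact: bm_kapM|exact: bm_cst].
rewrite -[LHS]fineK; last by have /integrable_fin_num := bm_integrable bi; exact.
congr EFin; rewrite /Kop /itg -RintegralZr//.
exact: (bm_integrable (bm_kapM x bf)).
Qed.

Let ker2G f g y : bm 0 1 f -> bm 0 1 g ->
  (\int[@lebesgue_measure R]_x ker2 f g (x, y) =
  (Kop g y * (f \_ box) y)%R%:E)%E.
Proof.
move=> bf bg; rewrite -(ker2E y bg bf); apply: eq_integral => x _.
by rewrite /ker2/= mulrAC (mulrC y x).
Qed.

Lemma bm_Kop f : bm 0 1 f -> bm 0 1 (Kop f).
Proof.
move=> bf; split; last first.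
  exists (1 + 4^-1 * ip f f) => x _.
  have := Kop_sqr_le x bf; rewrite -real_normK ?num_real//.
  by have := sqr_ge0 (`|Kop f x| - 1); have := ip_ge0 f; rewrite !expr2; lra.
(* With g = 1 the inner integral over y is [Kop f] on the box, and Fubini's theorem supplies its
   measurability. *)
have b1 := bm_cst 0 1 (1 : R).
have /(measurable_funTS (D := box)) mF := measurable_fubini_F (integrable_ker2 bf b1).
apply/measurable_EFinP.
apply: eq_measurable_fun mF => x xb; rewrite /fubini_F ker2E//.
by rewrite /patch xb mulr1.
Qed.

(** Self-adjointness, from Fubini's theorem and the symmetry of [kap (x * y)]. *)
Lemma ip_Kop f g : bm 0 1 f -> bm 0 1 g -> ip (Kop f) g = ip f (Kop g).
Proof.
move=> bf bg; have := Fubini (integrable_ker2 bf bg).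
under eq_integral do rewrite ker2E//.
under [in X in _ = X -> _]eq_integral do rewrite ker2G//.
move=> E; rewrite [RHS]ipC /ip /itg /Rintegral; congr fine.
rewrite [LHS]integral_mkcond [RHS]integral_mkcond.
transitivity (\int[@leb R]_x ((Kop f x * (g \_ box) x)%R)%:E)%E.
  apply: eq_integral => x _; rewrite /patch; case: ifP => // _.
  by rewrite mulr0.
rewrite [LHS]E; apply: eq_integral => x _; rewrite /patch; case: ifP => // _.
by rewrite mulr0.
Qed.

End Operator.

(** * Regularity of eigenfunctions *)

Section Regularity.
Variable R : realType.
Implicit Types (a b c d e x y t M : R) (f g : R -> R).

Lemma exprVn_small e : 0 < e -> exists k : nat, 2^-1 ^+ k < e :> R.
Proof.
move=> e0; have eV : 0 <= e^-1 by rewrite invr_ge0 ltW.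
exists (Num.bound e^-1); rewrite exprVn.
rewrite -[ltRHS]invrK ltf_pV2 ?posrE ?invr_gt0 ?exprn_gt0//.
apply: lt_trans (archi_boundP eV) _.
by rewrite -natrX ltr_nat; exact: ltn_expl.
Qed.

Lemma le_of_geometric (u v M : R) : 0 <= M -> (forall k : nat, u <= v + M * 2^-1 ^+ k) -> u <= v.
Proof.
move=> M0 h; apply/ler_addgt0Pr => e e0.
have M1 : 0 < M + 1 by lra.
have [k hk] := exprVn_small (divr_gt0 e0 M1).
apply: le_trans (h k) _; rewrite lerD2l.
have : (M + 1) * 2^-1 ^+ k < e by rewrite mulrC -ltr_pdivlMr.
have : 0 <= 2^-1 ^+ k :> R by rewrite exprn_ge0// invr_ge0.
nra.
Qed.

Lemma inv_diff_le d x x' : 0 < d -> d <= x -> x <= x' ->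
  x^-1 - x'^-1 <= (x' - x) / d ^+ 2.
Proof.
move=> d0 dx xx'; have x0 := lt_le_trans d0 dx; have x'0 := lt_le_trans x0 xx'.
have -> : x^-1 - x'^-1 = (x' - x) / (x * x') by field; rewrite !gt_eqF.
rewrite ler_wpM2l ?subr_ge0// lef_pV2 ?posrE ?mulr_gt0 ?exprn_gt0// expr2.
by apply: ler_pM; rewrite ?(ltW d0)//; exact: le_trans xx'.
Qed.

(** The part y < e costs at most its length, as kernel values differ by at most 1. On the rest
    [itg_kap_diff] applies, with x' / x and (1 - e) / e both at most 1/e. *)
Lemma itg_kap_modulus e x x' : 0 < e -> e <= x -> x <= x' -> x' <= 1 ->
  itg 0 1 (fun y => `|kap (x * y) - kap (x' * y)|) <= e + 3 * (x' - x) / e ^+ 3.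
Proof.
move=> e0 ex xx' x'1; have x0 := lt_le_trans e0 ex; have x'0 := lt_le_trans x0 xx'.
have e1 : e <= 1 by rewrite (le_trans ex)// (le_trans xx').
have bd a b : bm a b (fun y => `|kap (x * y) - kap (x' * y)|).
  by apply: bm_norm; apply: bmB; exact: bm_kap.
rewrite (itg_split (ltW e0) e1 (bd 0 1)); apply: lerD.
  rewrite -[leRHS]mul1r -[X in 1 * X]subr0; apply: itg_le_cst => //; first exact: ltW.
  move=> y _; have := kap_bound (x * y); have := kap_bound (x' * y).
  by have := ler_normB (kap (x * y)) (kap (x' * y)); lra.
apply: le_trans (itg_kap_diff e0 e1 x0 xx') _.
have V0 : 0 <= x^-1 - x'^-1 by rewrite subr_ge0 lef_pV2// posrE.
apply: (@le_trans _ _ ((x' - x) / e ^+ 2 * (3 * e^-1))); last first.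
  rewrite le_eqVlt; apply/orP; left; apply/eqP; by field; rewrite gt_eqF.
have eV0 : 0 < e^-1 by rewrite invr_gt0.
apply: ler_pM => //.
- by rewrite addr_ge0 ?divr_ge0 ?mulr_ge0 ?subr_ge0 ?(ltW e0) ?(ltW eV0) ?(ltW x0) ?(ltW x'0).
- exact: inv_diff_le.
have h1 : x' / x <= e^-1.
  rewrite -[leRHS]mul1r; apply: ler_pM; rewrite ?invr_ge0 ?(ltW x0) ?(ltW x'0)//.
  by rewrite lef_pV2 ?posrE.
have h2 : (1 - e) / e <= e^-1 by rewrite ler_piMl ?(ltW eV0)//; lra.
lra.
Qed.

(** On each block f is replaced by its value at the right endpoint: the constant part costs C x by
    [itg_kapM_bound], and the oscillation w costs w h / 2 since the kernel is at most 1/2. *)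
Lemma itg_kap_step f a h (m : nat) x C w : bm 0 1 f -> 0 < a -> 0 < h ->
  a + m%:R * h <= 1 -> 0 < x -> x <= 1 ->
  (forall y, 0 < y <= 1 -> `|f y| <= C) ->
  (forall y y', a <= y -> y <= y' -> y' <= 1 -> y' - y <= h -> `|f y - f y'| <= w) ->
  `|itg a (a + m%:R * h) (fun y => kap (x * y) * f y)| <= m%:R * (C * x + 2^-1 * w * h).
Proof.
move=> bf a0 h0 + x0 x1 fC fw; elim: m => [|m ih] am1.
  rewrite !mul0r addr0 /itg set_itv_ge ?bnd_simp ?ltxx//.
  by rewrite Rintegral_set0 normr0.
have m0 : 0 <= m%:R * h by rewrite mulr_ge0// ltW.
have mS : a + m.+1%:R * h = a + m%:R * h + h by rewrite -natr1 mulrDl mul1r addrA.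
rewrite mS in am1 *; set b := a + m%:R * h in ih am1 *.
have ab : a <= b by rewrite lerDl.
have bh : b <= b + h by rewrite lerDl ltW.
have bS u v g : 0 <= u -> v <= 1 -> bm 0 1 g -> bm u v g by move=> u0 v1; exact: bmS.
rewrite (itg_split ab bh); last by apply: (bS) => //; [exact: ltW|exact: bm_kapM].
apply: le_trans (ler_normD _ _) _.
rewrite -natr1 mulrDl mul1r; apply: lerD; first by apply: ih; exact: le_trans am1.
have b0 : 0 < b by exact: lt_le_trans ab.
have bk : bm b (b + h) (fun y => kap (x * y)) by exact: bm_kap.
have bfb : bm b (b + h) f by apply: (bS) => //; exact: ltW.
have E : itg b (b + h) (fun y => kap (x * y) * f y) =
  f (b + h) * itg b (b + h) (fun y => kap (x * y)) +
  itg b (b + h) (fun y => kap (x * y) * (f y - f (b + h))).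
  rewrite -itgZ// -itgD//; first last.
  - by apply: bmM => //; apply: bmB => //; exact: bm_cst.
  - by apply: bmZ.
  by apply: eq_itg => y _; ring.
rewrite E; apply: le_trans (ler_normD _ _) _; apply: lerD.
  rewrite normrM; apply: ler_pM => //; first by rewrite fC// am1 (lt_le_trans b0).
  exact: itg_kapM_bound.
rewrite -[X in _ * X](_ : b + h - b = h); last by ring.
apply: itg_bound => //.
  by apply: bmM => //; apply: bmB => //; exact: bm_cst.
move=> y /andP[yb ybh]; rewrite normrM ler_pM ?kap_bound// fw//; last by lra.
by rewrite ltW// (le_lt_trans ab).
Qed.

Section Eigenfunction.
Variables (phi : R -> R) (lam C : R).
Hypothesis bphi : bm 0 1 phi.
Hypothesis phiE : forall x, 0 < x <= 1 -> phi x = lam * Kop phi x.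
Hypothesis phiC : forall x, 0 < x <= 1 -> `|phi x| <= C.

Let C0 : 0 <= C.
Proof. by have := phiC (x := 1); rewrite ltr01 lexx => /(_ isT); apply: le_trans. Qed.

Let bphiS a b : 0 <= a -> b <= 1 -> bm a b phi.
Proof. by move=> a0 b1; exact: bmS bphi. Qed.

Lemma eigen_diff x x' : 0 < x <= 1 -> 0 < x' <= 1 ->
  `|phi x - phi x'| <=
  `|lam| * itg 0 1 (fun y => `|kap (x * y) - kap (x' * y)| * `|phi y|).
Proof.
move=> x01 x'01; rewrite (phiE x01) (phiE x'01) -mulrBr normrM ler_wpM2l//.
rewrite /Kop -itgB; do ?exact: bm_kapM.
apply: le_trans (itg_norm _) _.
  by apply: bmB; exact: bm_kapM.
rewrite le_eqVlt; apply/orP; left; apply/eqP/eq_itg => y _.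
by rewrite -normrM mulrBl.
Qed.

Lemma eigen_modulus e x x' : 0 < e -> e <= x -> x <= x' -> x' <= 1 ->
  `|phi x - phi x'| <= `|lam| * C * (e + 3 * (x' - x) / e ^+ 3).
Proof.
move=> e0 ex xx' x'1; have x0 := lt_le_trans e0 ex; have x'0 := lt_le_trans x0 xx'.
apply: le_trans (eigen_diff _ _) _; rewrite ?x0 ?x'0 ?x'1 ?(le_trans xx')//.
rewrite -mulrA ler_wpM2l//.
have bd : bm 0 1 (fun y => `|kap (x * y) - kap (x' * y)|).
  by apply: bm_norm; apply: bmB; exact: bm_kap.
apply: (@le_trans _ _ (C * itg 0 1 (fun y => `|kap (x * y) - kap (x' * y)|))).
  rewrite -itgZ//; apply: itg_le; [by apply: bmM => //; exact: bm_norm|exact: bmZ|].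
  by move=> y y01; rewrite mulrC ler_wpM2r// phiC.
by rewrite ler_wpM2l//; exact: itg_kap_modulus.
Qed.

(** Per unit of e in [eigen_decay]: C / 2 for y < e, C for the constant parts of the blocks, 2 |lam|
    C for the oscillations. *)
Let Dc := `|lam| * C * (2 + 2 * `|lam|).

Let Dc0 : 0 <= Dc.
Proof. by rewrite /Dc !mulr_ge0// addr_ge0// mulr_ge0. Qed.

(* phi is nearly constant on intervals of length e^4 in [e, 1], while the kernel
   has mean O(x) on each of them. *)
Lemma eigen_decay (k : nat) x : 0 < x -> x <= 2^-1 ^+ (5 * k) ->
  `|phi x| <= Dc * 2^-1 ^+ k.
Proof.
move=> x0 xk; set e : R := 2^-1 ^+ k.
have e0 : 0 < e by rewrite exprn_gt0// invr_gt0.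
have e1 : e <= 1 by rewrite exprn_ile1 ?invr_ge0//; lra.
have xe : x <= e ^+ 5 by rewrite /e -exprM mulnC.
have x1 : x <= 1 by rewrite (le_trans xe)// exprn_ile1// ltW.
(* As 1/e is a power of 2, (1 - e) / e^4 is an integer m, and m blocks of length e^4 tile [e, 1]
   exactly. *)
pose h := e ^+ 4; have h0 : 0 < h by rewrite exprn_gt0.
pose m : nat := (2 ^ (4 * k) - 2 ^ (3 * k))%N.
have eV n : (2 ^ (n * k))%N%:R = e^-1 ^+ n :> R.
  have -> : e^-1 = 2 ^+ k by rewrite /e exprVn invrK.
  by rewrite natrX mulnC exprM.
have mE : m%:R = e^-1 ^+ 4 - e^-1 ^+ 3.
  by rewrite natrB ?eV// leq_exp2l// leq_mul2r orbT.
have mh : e + m%:R * h = 1 by rewrite mE /h; field; rewrite gt_eqF.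
(* For points at distance at most e^4, [eigen_modulus] gives the factor e + 3 e^4 / e^3 = 4 e. *)
have step := @itg_kap_step phi e h m x C (`|lam| * C * (4 * e)) bphi e0 h0.
rewrite mh in step.
have {}step := step (lexx 1) x0 x1 phiC _.
have {step} h1 : `|itg e 1 (fun y => kap (x * y) * phi y)| <=
    m%:R * (C * x + 2^-1 * (`|lam| * C * (4 * e)) * h).
  apply: step => y y' ey yy' y'1 yh.
  apply: le_trans (eigen_modulus e0 ey yy' y'1) _.
  rewrite ler_wpM2l ?mulr_ge0//.
  have : 3 * (y' - y) / e ^+ 3 <= 3 * e.
    rewrite ler_pdivrMr ?exprn_gt0// -mulrA -exprS; rewrite /h in yh; lra.
  lra.
have h2 : `|itg 0 e (fun y => kap (x * y) * phi y)| <= 2^-1 * C * (e - 0).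
  apply: itg_bound; first exact: ltW.
    by apply: bmM; [exact: bm_kap|exact: bphiS].
  move=> y /andP[y0 ye]; rewrite normrM ler_pM ?kap_bound// phiC// y0.
  exact: le_trans ye e1.
have m1 : m%:R * h <= 1 by lra.
(* This is where the exponent 5 enters: about e^-4 blocks, each costing a multiple of x <= e^5. *)
have mx : m%:R * x <= e.
  apply: (@le_trans _ _ (m%:R * e ^+ 5)); first by rewrite ler_wpM2l.
  by rewrite exprSr -/h mulrA ler_piMl// ltW.
rewrite (phiE (x := x)); last by rewrite x0.
rewrite /Kop (itg_split (ltW e0) e1 (bm_kapM x bphi)) normrM /Dc -!mulrA.
rewrite ler_wpM2l//; apply: le_trans (ler_normD _ _) _.
have l0 := normr_ge0 lam.
have a1 : C * (m%:R * x) <= C * e by rewrite ler_wpM2l.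
have a2 : 2^-1 * (`|lam| * C * (4 * e)) * (m%:R * h) <= 2^-1 * (`|lam| * C * (4 * e)).
  by rewrite ler_piMr// !mulr_ge0// ?ltW// ?invr_gt0.
have a3 : 0 <= C * e by rewrite mulr_ge0// ltW.
lra.
Qed.

(* The variation of the kernel over a block [32^-(k+1), 32^-k] does not decay;
   the decay of phi makes the sum over the blocks converge. *)
Lemma eigen_lipschitz d : 0 < d -> exists2 L, 0 <= L &
  forall x x', d <= x -> x <= x' -> x' <= 1 -> `|phi x - phi x'| <= L * (x' - x).
Proof.
move=> d0; pose L := `|lam| * (2 * Dc * ((d^-1 + 62) / d ^+ 2)).
have dV0 : 0 < d^-1 by rewrite invr_gt0.
exists L.
  by rewrite !mulr_ge0 ?invr_ge0 ?exprn_ge0 ?(ltW d0)// addr_ge0 ?(ltW dV0).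
move=> x x' dx xx' x'1; have x0 := lt_le_trans d0 dx; have x'0 := lt_le_trans x0 xx'.
(* The bound of [itg_kap_diff] on a block [b/32, b]: x' / x <= 1/d, and 2 (b - a) / a = 2 * 31 =
   62. *)
set W := (x^-1 - x'^-1) * (d^-1 + 62).
have V0 : 0 <= x^-1 - x'^-1 by rewrite subr_ge0 lef_pV2// posrE.
have W0 : 0 <= W by rewrite mulr_ge0//; lra.
have x'x : x' / x <= d^-1.
  rewrite -[leRHS]mul1r; apply: ler_pM; rewrite ?invr_ge0 ?(ltW x0) ?(ltW x'0)//.
  by rewrite lef_pV2 ?posrE.
have bd a b : bm a b (fun y => `|kap (x * y) - kap (x' * y)|).
  by apply: bm_norm; apply: bmB; exact: bm_kap.
have bdp a b : 0 <= a -> b <= 1 -> bm a b (fun y => `|kap (x * y) - kap (x' * y)| * `|phi y|).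
  by move=> a0 b1; apply: bmM => //; apply: bm_norm; exact: bphiS.
have p0 n : 0 < 2^-1 ^+ n :> R by rewrite exprn_gt0// invr_gt0.
have p1 n : 2^-1 ^+ n <= 1 :> R by rewrite exprn_ile1 ?invr_ge0//; lra.
have pS n : 2^-1 ^+ (5 * n.+1) = 32^-1 * 2^-1 ^+ (5 * n) :> R.
  by rewrite mulnS exprD; congr (_ * _); rewrite exprVn; congr (_^-1); rewrite -natrX.
(* The factor 2 - 2 * 2^-k is the sum of the decay factors 2^-i over the blocks i < k. *)
have block (k : nat) : itg (2^-1 ^+ (5 * k)) 1 (fun y => `|kap (x * y) - kap (x' * y)| * `|phi y|)
    <= Dc * W * (2 - 2 * 2^-1 ^+ k).
  elim: k => [|k ih].
    by rewrite muln0 !expr0 /itg set_itv_ge ?bnd_simp ?ltxx// Rintegral_set0; lra.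
  set a := 2^-1 ^+ (5 * k.+1); set b := 2^-1 ^+ (5 * k) in ih.
  have ab : a <= b by rewrite /a /b pS; have := p0 (5 * k)%N; lra.
  rewrite (itg_split ab (p1 _)); last by apply: bdp => //; exact: ltW (p0 _).
  have h1 : itg a b (fun y => `|kap (x * y) - kap (x' * y)| * `|phi y|) <=
      Dc * 2^-1 ^+ k * W.
    apply: (@le_trans _ _ (Dc * 2^-1 ^+ k * itg a b (fun y => `|kap (x * y) - kap (x' * y)|))).
      rewrite -itgZ//; apply: itg_le.
      - by apply: bdp; [exact: ltW (p0 _)|exact: p1].
      - exact: bmZ.
      move=> y /andP[ay yb]; rewrite mulrC ler_wpM2r// eigen_decay//.
      exact: lt_trans (p0 _) ay.
    apply: ler_wpM2l; first by rewrite mulr_ge0// ltW.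
    apply: le_trans (itg_kap_diff (p0 _) ab x0 xx') _.
    rewrite /W ler_wpM2l//.
    have -> : (b - a) / a = 31 by rewrite /a /b pS; field; rewrite gt_eqF.
    lra.
  have -> : 2 - 2 * 2^-1 ^+ k.+1 = 2 - 2 * 2^-1 ^+ k + 2^-1 ^+ k :> R.
    by rewrite exprS; lra.
  by rewrite mulrDr; lra.
apply: le_trans (eigen_diff _ _) _; rewrite ?x0 ?x'0 ?x'1 ?(le_trans xx')//.
rewrite /L -[leRHS]mulrA ler_wpM2l//.
apply: (@le_trans _ _ (2 * Dc * W)); last first.
  rewrite -[leRHS]mulrA ler_wpM2l ?mulr_ge0// /W.
  have d62 : 0 <= d^-1 + 62 by lra.
  have h := ler_wpM2r d62 (inv_diff_le d0 dx xx').
  by apply: le_trans h _; rewrite le_eqVlt; apply/orP; left; apply/eqP; ring.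
(* The remaining part y < 32^-k costs at most C 32^-k, which vanishes in the limit. *)
apply: (le_of_geometric C0) => k.
rewrite (itg_split (ltW (p0 (5 * k)%N)) (p1 _) (bdp 0 1 (lexx 0) (lexx 1))).
rewrite addrC; apply: lerD.
  apply: le_trans (block k) _.
  have := mulr_ge0 (mulr_ge0 Dc0 W0) (ltW (p0 k)); lra.
apply: (@le_trans _ _ (C * (2^-1 ^+ (5 * k) - 0))).
  apply: itg_le_cst; first exact: ltW (p0 _).
    by apply: bdp => //; exact: p1.
  move=> y /andP[y0 yk]; rewrite -[leRHS]mul1r ler_pM//.
    have := kap_bound (x * y); have := kap_bound (x' * y).
    by have := ler_normB (kap (x * y)) (kap (x' * y)); lra.
  by rewrite phiC// y0 (le_trans yk).
rewrite subr0 ler_wpM2l//.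
by rewrite ler_wiXn2l ?invr_ge0 ?leq_pmull//; lra.
Qed.

(* The substitution y -> y / c expresses phi (c x) by the kernel at x, so that
   phi - phi (c .) solves the eigenvalue equation up to O(1 - c).  The part of
   the integral over y < d is a contraction when |lam| d is small, and the
   Lipschitz bound covers the rest. *)
Lemma eigen_log_lipschitz : exists2 A, 0 <= A & forall c x,
  2^-1 <= c -> c < 1 -> 0 < x <= 1 -> `|phi x - phi (c * x)| <= A * (1 - c).
Proof.
have l0 := normr_ge0 lam.
(* This choice gives |lam| d <= 1/2, so the part y < d contracts, and d <= 1/2 <= c. *)
pose d : R := (2 * (1 + `|lam|))^-1.
have d0 : 0 < d by rewrite invr_gt0; lra.
have d2 : d <= 2^-1 by rewrite lef_pV2 ?posrE; lra.
have ld : `|lam| * d <= 2^-1.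
  rewrite /d invfM mulrCA ler_piMr ?invr_ge0// ler_pdivrMr; lra.
have [L L0 lipL] := eigen_lipschitz d0.
(* The terms come, in order, from y > c, from the factor 1 - c in front of phi (c x), and from d < y
   <= c. *)
pose A := `|lam| * C / 2 + C + `|lam| * L / 2.
have A0 : 0 <= A by rewrite !addr_ge0// !mulr_ge0// ?invr_ge0.
exists (2 * A); first by rewrite mulr_ge0.
move=> c x c2 c1; move: x.
have c0 : 0 < c by lra.
have cV0 : 0 < c^-1 by rewrite invr_gt0.
have cc : c * c^-1 = 1 by rewrite divff// gt_eqF.
have contract S : 0 <= S -> (forall x, 0 < x <= 1 -> `|phi x - phi (c * x)| <= S) ->
    forall x, 0 < x <= 1 -> `|phi x - phi (c * x)| <= A * (1 - c) + S / 2.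
  move=> S0 hS x /andP[x0 x1].
  pose g t := kap (x * t) * phi (c^-1 * t).
  have bpc : bm 0 c (fun t => phi (c^-1 * t)).
    by apply: bm_scale => //; rewrite mulr0 mulrC cc.
  have bg : bm 0 c g by apply: bmM => //; exact: bm_kap.
  have cx0 : 0 < c * x <= 1 by rewrite mulr_gt0//= mulr_ile1// ltW.
  have E1 : phi (c * x) = lam * c^-1 * itg 0 c g.
    rewrite (phiE cx0) -mulrA; congr (_ * _).
    have := @itg_scale R 0 1 c g c0; rewrite mulr0 mulr1 => /(_ bg) <-.
    apply: eq_itg => y _; rewrite /g (mulrA c^-1) mulVf ?gt_eqF// mul1r.
    by congr (kap _ * _); ring.
  have E2 : phi x = lam * (itg 0 c (fun y => kap (x * y) * phi y) +
      itg c 1 (fun y => kap (x * y) * phi y)).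
    rewrite (phiE (x := x)) ?x0//; congr (_ * _).
    by rewrite /Kop (itg_split (ltW c0) (ltW c1) (bm_kapM x bphi)).
  have bp : bm 0 c phi by apply: bphiS => //; exact: ltW.
  have bk a b : bm a b (fun y => kap (x * y)) by exact: bm_kap.
  (* The scaled equation expresses c phi (c x), not phi (c x), as an integral with kernel at x; this
     leaves (1 - c) phi (c x). *)
  have E3 : phi x - phi (c * x) = lam * itg c 1 (fun y => kap (x * y) * phi y) +
      lam * itg 0 c (fun y => kap (x * y) * (phi y - phi (c^-1 * y))) -
      (1 - c) * phi (c * x).
    have -> : itg 0 c (fun y => kap (x * y) * (phi y - phi (c^-1 * y))) =
        itg 0 c (fun y => kap (x * y) * phi y) - itg 0 c g.
      rewrite -itgB//; last exact: bmM.
      by apply: eq_itg => y _; rewrite mulrBr.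
    rewrite E1 {1}E2; have : c * (lam * c^-1 * itg 0 c g) = lam * itg 0 c g.
      by field; rewrite gt_eqF.
    lra.
  have h1 : `|itg c 1 (fun y => kap (x * y) * phi y)| <= 2^-1 * C * (1 - c).
    apply: itg_bound; first exact: ltW.
      by apply: bmM => //; apply: bphiS => //; exact: ltW.
    move=> y /andP[cy y1]; rewrite normrM ler_pM ?kap_bound// phiC// y1 andbT.
    exact: lt_trans cy.
  have bdf a b : 0 <= a -> b <= c -> bm a b (fun y => kap (x * y) * (phi y - phi (c^-1 * y))).
    move=> a0 bc; apply: bmS a0 bc _.
    by apply: bmM => //; apply: bmB.
  have cy1 y : 0 < y -> y <= c -> 0 < c^-1 * y <= 1.
    by move=> y0 yc; rewrite mulr_gt0//= mulrC ler_pdivrMr// mul1r.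
  have h2 : `|itg 0 d (fun y => kap (x * y) * (phi y - phi (c^-1 * y)))| <= 2^-1 * S * (d - 0).
    apply: itg_bound; [exact: ltW|by apply: bdf => //; lra|].
    move=> y /andP[y0 yd]; rewrite normrM ler_pM ?kap_bound// distrC.
    (* The assumed bound S is used at the point y / c, which lies in (0, 1] since y <= d <= c. *)
    have {2}-> : y = c * (c^-1 * y) by rewrite mulrA cc mul1r.
    by apply: hS; apply: cy1 => //; lra.
  have h3 : `|itg d c (fun y => kap (x * y) * (phi y - phi (c^-1 * y)))| <=
      2^-1 * (L * (1 - c)) * (c - d).
    apply: itg_bound; [lra|by apply: bdf => //; exact: ltW|].
    move=> y /andP[dy yc]; have y0 := lt_trans d0 dy.
    rewrite normrM ler_pM ?kap_bound//.
    have /andP[_ cy] := cy1 y y0 yc.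
    have yy : y <= c^-1 * y.
      by rewrite -[leLHS]mul1r ler_pM2r// -(invr1 R) lef_pV2 ?posrE// ltW.
    apply: le_trans (lipL _ _ (ltW dy) yy cy) _; rewrite ler_wpM2l//.
    have -> : c^-1 * y - y = (1 - c) * (c^-1 * y) by field; rewrite gt_eqF.
    by rewrite ler_piMr// subr_ge0 ltW.
  have h4 : `|phi (c * x)| <= C by exact: phiC.
  have dc : d <= c by lra.
  rewrite E3 (itg_split (ltW d0) dc (bdf _ _ (lexx _) (lexx _))).
  apply: le_trans (ler_normB _ _) _.
  apply: le_trans (lerD (ler_normD _ _) (lexx _)) _.
  rewrite !normrM (ger0_norm (x := 1 - c)); last lra.
  have h23 := le_trans (ler_normD _ _) (lerD h2 h3).
  have {}h1 := ler_wpM2l l0 h1.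
  have {}h23 := ler_wpM2l l0 h23.
  have c10 : 0 <= 1 - c by lra.
  have {}h4 := ler_wpM2l c10 h4.
  have h5 : `|lam| * d * S <= 2^-1 * S by rewrite ler_wpM2r.
  have h6 : `|lam| * (L * (1 - c)) * (c - d) <= `|lam| * (L * (1 - c)).
    by rewrite ler_piMr ?mulr_ge0//; lra.
  rewrite /A; lra.
(* From the trivial bound 2 C on, each use of [contract] halves the excess over the fixed point 2 A
   (1 - c). *)
move=> x x01; apply: (@le_of_geometric _ _ (2 * C)); first by rewrite mulr_ge0.
move=> k; elim: k x x01 => [|k ih] x x01.
  rewrite expr0 mulr1; have /andP[x0 x1] := x01.
  have cx0 : 0 < c * x <= 1 by rewrite mulr_gt0//= mulr_ile1// ltW.
  apply: le_trans (ler_normB _ _) _.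
  have := phiC x01; have := phiC cx0; have := mulr_ge0 A0 (_ : 0 <= 1 - c); lra.
have c10 : 0 <= 1 - c by lra.
have p0 : 0 <= 2^-1 ^+ k :> R by rewrite exprn_ge0// invr_ge0.
have S0 : 0 <= 2 * A * (1 - c) + 2 * C * 2^-1 ^+ k by rewrite addr_ge0// !mulr_ge0.
by apply: le_trans (contract _ S0 ih x x01) _; rewrite exprS; lra.
Qed.

End Eigenfunction.
End Regularity.

(** * The function y phi'(y) *)

Section EulerDerivative.
Variable R : realType.
Implicit Types (a b c d e x y z t M : R) (f g : R -> R).

Lemma bigcapT_measurable_rat (dd : measure_display) (T : measurableType dd) (F : rat -> set T) :
  (forall r, measurable (F r)) -> measurable (\bigcap_r F r).
Proof.
move=> mF; rewrite -[X in measurable X]setCK setC_bigcap; apply: measurableC.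
by apply: bigcupT_measurable_rat => r; exact: measurableC.
Qed.

Lemma natV_small e : 0 < e -> exists n : nat, n.+1%:R^-1 < e.
Proof.
move=> e0; have eV : 0 <= e^-1 by rewrite invr_ge0 ltW.
exists (Num.bound e^-1); rewrite -[ltRHS]invrK ltf_pV2 ?posrE ?invr_gt0//.
by apply: lt_trans (archi_boundP eV) _; rewrite ltr_nat.
Qed.

Lemma derivable_quotient f y : derivable f y 1 -> forall e, 0 < e ->
  exists2 d, 0 < d & forall h, h != 0 -> `|h| < d ->
    `|h^-1 * (f (h + y) - f y) - derive1 f y| <= e.
Proof.
move=> df e e0.
have : (fun h => h^-1 *: (f (h + y) - f y)) @ 0^' --> derive1 f y.
  rewrite derive1E; have -> : (fun h => h^-1 *: (f (h + y) - f y)) =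
    (fun h => h^-1 *: ((f \o shift y) (h *: 1) - f y)).
    by apply/funext => h /=; rewrite [h%:A]mulr1.
  exact: df.
move/cvgrPdist_le => /(_ e e0); rewrite near_withinE => /nbhs_ballP[d /= d0 hd].
exists d => // h h0 hd'; rewrite distrC; apply: hd => //.
by rewrite /ball/= sub0r normrN.
Qed.

(** Since l may depend on e, this is the Cauchy criterion and yields derivability without a
    candidate for the derivative. *)
Lemma quotient_derivable f y : (forall e, 0 < e -> exists l, exists2 d, 0 < d &
    forall h, h != 0 -> `|h| < d -> `|h^-1 * (f (h + y) - f y) - l| < e) ->
  derivable f y 1.
Proof.
move=> H; rewrite /derivable; apply: cauchy_cvg; apply: cauchy_exP => e e0.
have [l [d d0 hd]] := H e e0; exists l.
rewrite /fmap/= -/(nbhs _ _) near_simpl near_withinE; apply/nbhs_ballP; exists d => //= h.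
rewrite /ball/= sub0r normrN => hd' h0.
by rewrite distrC [h%:A]mulr1; exact: hd.
Qed.

Variables (phi : R -> R).
Hypothesis bphi : bm 0 1 phi.
Hypothesis lip : forall d, 0 < d -> exists2 L, 0 <= L &
  forall x x', d <= x -> x <= x' -> x' <= 1 -> `|phi x - phi x'| <= L * (x' - x).
Hypothesis loglip : exists2 A, 0 <= A & forall c x,
  2^-1 <= c -> c < 1 -> 0 < x <= 1 -> `|phi x - phi (c * x)| <= A * (1 - c).

(** The hypotheses make phi measurable on (0, 1] only; the zero extension makes [gq c] measurable on
    the whole line, also where c y leaves the interval. *)
Let phit := phi \_ (`]0%R, 1%R]%classic : set R).

Let phitE x : 0 < x <= 1 -> phit x = phi x.
Proof. by move=> x01; rewrite /phit /patch mem_set// in_oc. Qed.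

Let mphit : measurable_fun setT phit.
Proof. by apply: (measurable_restrictT phi (measurable_itv _)).1; case: bphi. Qed.

(* Difference quotient in the logarithmic variable. *)
Let gq (c : R) y := (phit (c * y) - phit y) / (c - 1).

Let good (m : nat) (c : R) := 0 < `|c - 1| < m.+1%:R^-1.

(** Continuity in c carries an oscillation bound from rational c to all c. *)
Let gq_cont y c : 0 < y < 1 -> 0 < c -> c * y < 1 -> c != 1 -> forall e, 0 < e ->
  exists2 d, 0 < d & forall c', `|c' - c| < d -> `|gq c' y - gq c y| <= e.
Proof.
move=> /andP[y0 y1] c0 cy1 cn1 e e0.
have cy0 : 0 < c * y by rewrite mulr_gt0.
have [L L0 hL] := lip (d := c * y / 2) ltac:(lra).
have cphi : {for c, continuous (fun c' => phit (c' * y))}.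
  apply/cvgrPdist_le => eps eps0.
  have L1 : 0 < L + 1 by lra.
  (* The three radii keep c' y above c y / 2, where L is valid, keep c' y below 1, and make L |c -
     c'| at most eps. *)
  apply/nbhs_ballP; exists (Num.min (c / 2) (Num.min ((1 - c * y) / y) (eps / (L + 1)))).
    by rewrite /= !lt_min !divr_gt0//; lra.
  move=> c'; rewrite /ball/= !lt_min => /and3P[h1 h2 h3].
  rewrite ltr_pdivlMr// in h2; rewrite ltr_pdivlMr// in h3.
  rewrite ltr_norml in h1.
  have h4 : `|c * y - c' * y| < 1 - c * y by rewrite -mulrBl normrM (gtr0_norm y0).
  rewrite ltr_norml in h4.
  have c'y : c * y / 2 <= c' * y by rewrite mulrAC ler_pM2r//; lra.
  have c'1 : c' * y <= 1 by lra.
  rewrite !phitE; [|by rewrite (lt_le_trans _ c'y)//; lra|by rewrite cy0 ltW].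
  have key : `|phi (c * y) - phi (c' * y)| <= L * `|c * y - c' * y|.
    case: (leP (c * y) (c' * y)) => cc.
      by rewrite [X in _ <= _ * X]ler0_norm ?subr_le0// opprB; apply: hL => //; lra.
    rewrite distrC [X in _ <= _ * X]ger0_norm ?subr_ge0 ?(ltW cc)//.
    by apply: hL => //; lra.
  apply: le_trans key _; rewrite -mulrBl normrM (gtr0_norm y0).
  have := normr_ge0 (c - c') => n0.
  apply: (@le_trans _ _ (L * `|c - c'|)).
    by rewrite ler_wpM2l// ler_piMr// ltW.
  apply: le_trans (ltW h3); rewrite mulrC ler_wpM2l//; lra.
have : {for c, continuous (fun c' => gq c' y)}.
  apply: cvgM; first by apply: cvgB; [exact: cphi|exact: cvg_cst].
  apply: cvgV; first by rewrite subr_eq0.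
  by apply: cvgB; [exact: cvg_id|exact: cvg_cst].
move/cvgrPdist_le => /(_ e e0) /nbhs_ballP[d /= d0 hd]; exists d => // c' cd.
by rewrite distrC; apply: hd; rewrite /ball/= distrC.
Qed.

(** As c -> 1, [gq c y] is y times the difference quotient with increment (c - 1) y. The Cauchy
    criterion over rational c involves countable quantifiers only, which yields measurability. *)
Let derivableP_rat y : 0 < y < 1 -> derivable phi y 1 <->
  forall n : nat, exists m : nat, forall r s : rat, good m (ratr r) -> good m (ratr s) ->
    `|gq (ratr r) y - gq (ratr s) y| <= n.+1%:R^-1.
Proof.
move=> /andP[y0 y1]; split => [dphi n|H].
  have n0 : 0 < n.+1%:R^-1 :> R by rewrite invr_gt0.
  have n02 : 0 < n.+1%:R^-1 / 2 :> R by rewrite divr_gt0.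
  have [d d0 hd] := derivable_quotient dphi n02.
  have [m hm] := natV_small (e := Num.min (Num.min 1 (1 - y)) d) ltac:(by rewrite !lt_min ltr01 d0 subr_gt0 y1).
  move: hm; rewrite !lt_min => /andP[/andP[m1 my] md].
  have main c : good m c -> `|gq c y - y * derive1 phi y| <= n.+1%:R^-1 / 2.
    move=> /andP[c10]; move: (m.+1%:R^-1) m1 my md => mm m1 my md cm.
    have cn : c - 1 != 0 by rewrite -normr_gt0.
    have cm' := cm; rewrite ltr_norml in cm'.
    have cy : 0 < c * y <= 1.
      rewrite mulr_gt0 ?y0//=; last lra.
      apply: (@le_trans _ _ ((2 - y) * y)); first by rewrite ler_pM2r//; lra.
      have := sqr_ge0 (1 - y); rewrite expr2; lra.
    rewrite /gq !phitE//; last by rewrite y0 ltW.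
    have h0 : (c - 1) * y != 0 by rewrite mulf_neq0// gt_eqF.
    have := hd ((c - 1) * y) h0.
    have -> : (c - 1) * y + y = c * y by ring.
    have -> : (phi (c * y) - phi y) / (c - 1) - y * derive1 phi y =
      y * (((c - 1) * y)^-1 * (phi (c * y) - phi y) - derive1 phi y).
      by field; rewrite cn gt_eqF.
    rewrite !normrM (gtr0_norm y0) => hh.
    have : `|c - 1| * y < d.
      by apply: le_lt_trans (lt_trans cm md); rewrite ler_piMr// ltW.
    move/hh => {}hh; apply: le_trans hh; rewrite ler_piMl// ltW//.
  exists m => r s /main hr /main hs.
  rewrite (_ : gq _ _ - gq _ _ = (gq (ratr r) y - y * derive1 phi y) -
    (gq (ratr s) y - y * derive1 phi y)); last by ring.
  by apply: le_trans (ler_normB _ _) _; rewrite [leRHS]splitr lerD.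
apply: quotient_derivable => e e0.
have [n hn] := natV_small (mulr_gt0 e0 y0); have [m hm] := H n.
have m0 : 0 < m.+1%:R^-1 :> R by rewrite invr_gt0.
have m1 : m.+1%:R^-1 <= 1 :> R by rewrite invf_le1// ler1n.
(* One rational near 1 serves as reference for all c; dividing its quotient by y approximates the
   derivative. *)
have [s0 ] := @rat_in_itvoo R 1 (1 + m.+1%:R^-1) ltac:(by rewrite ltrDl).
rewrite in_itv/= => /andP[s1 sm].
have gs0 : good m (ratr s0).
  rewrite /good; move: (m.+1%:R^-1) m0 sm => mm m0 sm; rewrite normr_gt0 ltr_norml.
  by apply/andP; split; [rewrite gt_eqF//; lra|lra].
exists (gq (ratr s0) y / y); exists (Num.min (y / m.+1%:R) (1 - y)).
  by rewrite lt_min divr_gt0// subr_gt0 y1.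
move=> h h0; rewrite lt_min => /andP[h1 h2].
pose c := 1 + h / y.
have c1 : c - 1 = h / y by rewrite /c addrC addKr.
have cy : c * y = h + y by rewrite /c mulrDl mul1r divfK ?gt_eqF// addrC.
have gc : good m c.
  rewrite /good c1 normr_gt0 mulf_neq0//= ?invr_eq0 ?gt_eqF//.
  by rewrite normrM normfV (gtr0_norm y0) ltr_pdivrMr// mulrC.
have /andP[gc1 gc2] := gc.
have cn1 : c != 1 by rewrite -subr_eq0 -normr_gt0.
have c0 : 0 < c by move: (m.+1%:R^-1) m1 gc2 => mm m1; rewrite ltr_norml; lra.
have cy1 : c * y < 1 by rewrite cy; move: h2; rewrite ltr_norml; lra.
have hy0 : 0 < h + y by rewrite -cy mulr_gt0.
suff key : `|gq c y - gq (ratr s0) y| <= n.+1%:R^-1.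
  have -> : h^-1 * (phi (h + y) - phi y) - gq (ratr s0) y / y = (gq c y - gq (ratr s0) y) / y.
    rewrite {2}/gq c1 !phitE ?y0 ?cy ?hy0 ?(ltW y1) ?(ltW cy1)//; last by rewrite -cy ltW.
    by field; rewrite h0 gt_eqF.
  rewrite normrM normfV (gtr0_norm y0) ltr_pdivrMr//.
  exact: le_lt_trans hn.
apply/ler_addgt0Pr => eps eps0.
have [d d0 hd] := gq_cont (y := y) (c := c) ltac:(by rewrite y0) c0 cy1 cn1 eps0.
have e' : 0 < Num.min d (Num.min `|c - 1| (m.+1%:R^-1 - `|c - 1|)).
  by rewrite !lt_min d0 gc1 subr_gt0.
(* A rational just above c: within d for [gq_cont], and so close that it remains [good]. *)
have [r] := @rat_in_itvoo R c (c + Num.min d (Num.min `|c - 1| (m.+1%:R^-1 - `|c - 1|))) ltac:(by rewrite ltrDl).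
rewrite in_itv/= => /andP[cr]; rewrite -ltrBlDl !lt_min => /and3P[r1 r2 r3].
have rc : `|ratr r - c| = ratr r - c by rewrite ger0_norm// subr_ge0 ltW.
have gr : good m (ratr r).
  rewrite /good; move: (m.+1%:R^-1) r3 => mm r3; apply/andP; split.
    have := ler_normB (ratr r - 1) (ratr r - c); rewrite rc.
    have -> : ratr r - 1 - (ratr r - c) = c - 1 by ring.
    lra.
  have := ler_normD (c - 1) (ratr r - c); rewrite rc.
  have -> : c - 1 + (ratr r - c) = ratr r - 1 by ring.
  lra.
have := hd (ratr r); rewrite rc => /(_ r1) hr.
rewrite (_ : gq c y - gq (ratr s0) y = (gq (ratr r) y - gq (ratr s0) y) - (gq (ratr r) y - gq c y)); last by ring.
by apply: le_trans (ler_normB _ _) _; rewrite lerD// hm.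
Qed.

Let Dset : set R := [set y | 0 < y < 1 /\ derivable phi y 1].

Let mDset : measurable Dset.
Proof.
pose E (n m : nat) (r s : rat) : set R := [set y | good m (ratr r) -> good m (ratr s) ->
    `|gq (ratr r) y - gq (ratr s) y| <= n.+1%:R^-1].
have mgq c : measurable_fun setT (gq c).
  apply: measurable_funM; last exact: measurable_cst.
  apply: measurable_funB => //; apply: measurableT_comp => //.
have mE n m r s : measurable (E n m r s).
  rewrite /E; case: (good m (ratr r)) => /=; last first.
    rewrite (_ : [set _ | _] = setT); first exact: measurableT.
    by apply/seteqP; split.
  case: (good m (ratr s)) => /=; last first.
    rewrite (_ : [set _ | _] = setT); first exact: measurableT.
    by apply/seteqP; split.
  have mf : measurable_fun setT (fun y => `|gq (ratr r) y - gq (ratr s) y|).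
    by apply: measurableT_comp => //; exact: measurable_funB.
  have mc : measurable_fun setT (fun _ : R => n.+1%:R^-1 : R) by exact: measurable_cst.
  have := measurable_fun_ler mf mc measurableT (Y := [set true]) I.
  rewrite setTI; congr measurable; apply/seteqP; split => y /=; first by [].
  by move=> /(_ isT isT).
have -> : Dset = `]0, 1[ `&` \bigcap_n \bigcup_m \bigcap_r \bigcap_s E n m r s.
  apply/seteqP; split => y /=; rewrite in_itv/=.
    move=> [y01 /(derivableP_rat y01) H]; split => // n _.
    by have [m hm] := H n; exists m => // r _ s _; exact: hm.
  move=> [y01 H]; split => //; apply/(derivableP_rat y01) => n.
  by have [m _ hm] := H n I; exists m => r s; exact: hm.
apply: measurableI; first exact: measurable_itv.
apply: bigcapT_measurable => n; apply: bigcupT_measurable => m.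
by apply: bigcapT_measurable_rat => r; exact: bigcapT_measurable_rat.
Qed.

(** On the derivability set, y phi'(y) is the limit of (phi y - phi (c y)) / (1 - c) as c -> 1;
    these quotients are measurable and bounded by A through [loglip]. *)
Lemma bm_QofPhi : bm 0 1 (QofPhi phi).
Proof.
have [A A0 hA] := loglip.
(* The shift by 2 keeps c n in [1/2, 1), as [loglip] requires. *)
pose c (n : nat) : R := 1 - n.+2%:R^-1.
have n2 (n : nat) : 0 < (n.+2%:R^-1 : R) <= 2^-1.
  by rewrite invr_gt0 ltr0n/= lef_pV2 ?posrE ?ltr0n// ler_nat.
pose F n y : R := \1_Dset y * (n.+2%:R * (phi y - phi (c n * y))).
apply: (@bm_cvg _ _ _ F _ A).
- move=> n; apply: bmM.
    split; first exact: measurable_indic.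
    by exists 1 => x _; rewrite indicE ger0_norm// lern1 leq_b1.
  apply: bmZ; apply: bmB => //.
  rewrite /c; move: (n.+2%:R^-1) (n2 n) => u /andP[u0 u2].
  apply: bm_scale; rewrite ?mulr0; first by lra.
  by apply: bmS bphi => //; lra.
- move=> n x x01.
  rewrite /F indicE; case: (x \in Dset); rewrite ?mul0r ?normr0// mul1r.
  rewrite normrM ger0_norm//.
  rewrite mulrC -ler_pdivlMr ?ltr0n// /c.
  move: (n.+2%:R^-1) (n2 n) => u /andP[u0 u2].
  have h : `|phi x - phi ((1 - u) * x)| <= A * (1 - (1 - u)) by apply: hA => //; lra.
  by apply: le_trans h _; rewrite opprB addrC subrK.
- move=> y /andP[y0 y1]; rewrite /QofPhi.
  case: asboolP => [[y01 dy]|nD]; last first.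
    rewrite (_ : F ^~ y = fun=> 0); first exact: cvg_cst.
    by apply/funext => n; rewrite /F indicE memNset ?mul0r.
  apply/cvgrPdist_le => e e0.
  have [d d0 hd] := derivable_quotient dy e0.
  have [N hN] := natV_small d0.
  exists N => // n /= Nn.
  have -> : F n y = y * ((- (y / n.+2%:R))^-1 * (phi (- (y / n.+2%:R) + y) - phi y)).
    rewrite /F indicE mem_set// mul1r (_ : - (y / n.+2%:R) + y = c n * y); last by rewrite /c; ring.
    have : n.+2%:R != 0 :> R by rewrite pnatr_eq0.
    move: (phi (c n * y)) (n.+2%:R : R) => p u u0.
    by field; rewrite u0 gt_eqF.
  rewrite -mulrBr normrM (gtr0_norm y0) distrC.
  apply: (@le_trans _ _ (1 * e)); last by rewrite mul1r.
  apply: ler_pM => //; first exact: ltW.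
  apply: hd; first by rewrite oppr_eq0 mulf_neq0 ?invr_eq0 ?pnatr_eq0// gt_eqF.
  rewrite normrN ger0_norm ?divr_ge0 ?(ltW y0)//.
  apply: le_lt_trans hN; rewrite -[leRHS]mul1r ler_pM ?(ltW y0) ?invr_ge0//.
  by rewrite lef_pV2 ?posrE// ler_nat ltnS (leq_trans Nn).
Qed.

End EulerDerivative.

(** * Spectral theory *)

Section Convergence.
Variable R : realType.
Implicit Types (a b c d e x y z t M B : R) (f g : R -> R).

(** By Tychonoff's theorem the sequence has a cluster point p in a compact cube; s k is an index k
    or later at which the first k+1 coordinates are close to p. *)
Lemma diagonal_subsequence (u : nat -> nat -> R) M : (forall n i, `|u n i| <= M) ->
  exists (p : nat -> R) (s : nat -> nat), (forall k, (k <= s k)%N) /\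
    forall k i, (i <= k)%N -> `|u (s k) i - p i| < k.+1%:R^-1.
Proof.
move=> uM.
have cA := @tychonoff nat (fun=> R) (fun=> `[- M, M]%classic) (fun=> @segment_compact R _ _).
pose U n : prod_topology (fun _ : nat => R) := u n.
have [|p [_ clp]] := cA (U @ \oo) _.
  by exists 0%N => // n _ i; rewrite /= in_itv/= -ler_norml uM.
have ex k : exists n, (k <= n)%N /\ forall i, (i <= k)%N -> `|u n i - p i| < k.+1%:R^-1.
  pose A : set (prod_topology (fun _ : nat => R)) := [set f | exists2 n, (k <= n)%N & f = U n].
  pose N : set (prod_topology (fun _ : nat => R)) :=
    [set f | forall i : 'I_k.+1, `|f i - p i| < k.+1%:R^-1].
  have FA : (U @ \oo) A by exists k => // n /= kn; exists n.
  have nN : nbhs (p : prod_topology (fun _ : nat => R)) N.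
    apply: (@filter_forall _ 'I_k.+1 (fun i => [set f : prod_topology (fun _ : nat => R) |
      `|f i - p i| < k.+1%:R^-1]) (nbhs (p : prod_topology (fun _ : nat => R))) _) => i.
    have nb : nbhs (p i) [set z | `|z - p i| < k.+1%:R^-1].
      apply/nbhs_ballP; exists k.+1%:R^-1; first by rewrite /= invr_gt0.
      by move=> z; rewrite /ball/= distrC.
    exact: (@proj_continuous nat (fun=> R) i p _ nb).
  have [_ [[n kn ->] hn]] := clp _ _ FA nN.
  by exists n; split => // i ik; exact: (hn (Ordinal (ik : (i < k.+1)%N))).
have [s hs] := choice ex.
by exists p, s; split => [k|k i ik]; [case: (hs k)|case: (hs k) => _; exact].
Qed.

Lemma itg_cvg (F : nat -> R -> R) f M : (forall n, bm 0 1 (F n)) ->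
  (forall n x, 0 < x <= 1 -> `|F n x| <= M) ->
  (forall x, 0 < x <= 1 -> F ^~ x @ \oo --> f x) ->
  (fun n => itg 0 1 (F n)) @ \oo --> itg 0 1 f.
Proof.
move=> bF FM Ff; have bf := bm_cvg bF FM Ff.
have [] := @dominated_convergence _ _ R (@leb R) `]0%R, 1%R]%classic (measurable_itv _)
  (fun n => EFin \o F n) (EFin \o f) (fun=> M%:E).
- by move=> n; apply/measurable_EFinP; case: (bF n).
- by apply/measurable_EFinP; case: bf.
- by apply: aeW => x; rewrite in_oc => x01; apply: cvg_EFin; [exact: nearW|exact: Ff].
- exact: (bm_integrable (bm_cst 0 1 M)).
- by apply: aeW => x n; rewrite in_oc => x01; rewrite lee_fin FM.
move=> _ _ C; apply: fine_cvg.
rewrite fineK; last by have /integrable_fin_num := bm_integrable bf; exact.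
exact: C.
Qed.

(** Left neighbourhoods suffice: they stay in (0, 1], contain rationals and have positive length. *)
Lemma equicontinuous_Kop x e B : 0 < x <= 1 -> 0 < e -> 0 <= B -> exists2 d, 0 < d <= x &
  forall f x', bm 0 1 f -> ip f f <= B -> x - d < x' <= x -> `|Kop f x - Kop f x'| <= e.
Proof.
move=> /andP[x0 x1] e0 B0.
have B1 : 0 < 2 * (B + 1) by lra.
(* With d <= u^4 / 3 the kernel modulus is at most u + 3 d / u^3 <= 2 u, and the choice of u makes 2
   u B <= e^2. *)
pose u := Num.min (x / 2) (e ^+ 2 / (2 * (B + 1))).
have u0 : 0 < u by rewrite lt_min !divr_gt0// exprn_gt0.
have ux : u <= x / 2 by rewrite ge_min lexx.
have ue : u * (2 * (B + 1)) <= e ^+ 2 by rewrite -ler_pdivlMr// ge_min lexx orbT.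
pose d := Num.min (x / 2) (u ^+ 4 / 3).
have d0 : 0 < d by rewrite lt_min !divr_gt0// exprn_gt0.
have dx : d <= x / 2 by rewrite ge_min lexx.
have du : 3 * d <= u ^+ 4.
  by rewrite mulrC -ler_pdivlMr// ge_min lexx orbT.
exists d; first by rewrite d0; lra.
move=> f x' bf fB /andP[x'd x'x].
rewrite -(@ler_sqr _ _ e) ?nnegrE ?(ltW e0)// real_normK ?num_real//.
rewrite -[X in X <= _]sqrrN opprB.
apply: le_trans (Kop_diff_sqr_le _ _ bf) _.
have ux' : u <= x' by lra.
have h1 := itg_kap_modulus u0 ux' x'x x1.
have h2 : 3 * (x - x') / u ^+ 3 <= u.
  by rewrite ler_pdivrMr ?exprn_gt0// -exprS; lra.
apply: (@le_trans _ _ (2 * u * B)); last by lra.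
apply: ler_pM => //; last by lra.
- by apply: itg_ge0.
- exact: ip_ge0.
Qed.

Lemma Kop0 f : Kop f 0 = 0.
Proof.
rewrite /Kop (@eq_itg _ _ _ _ (fun=> 0)); last by move=> y _; rewrite /kap mul0r ltxx mul0r.
by rewrite itg_cst// mul0r.
Qed.

End Convergence.

(** * Vanishing of the operator on the complement of the eigenfunctions *)

Section Spectral.
Variable R : realType.
Implicit Types (a b c d e x y z t M B : R) (f g : R -> R).

Lemma ip_Kop_le f : bm 0 1 f -> ip (Kop f) (Kop f) <= 4^-1 * ip f f.
Proof.
move=> bf; rewrite -[leRHS]mulr1 -[X in _ * X](subr0 1); apply: itg_le_cst => //.
  by apply: bmM; exact: bm_Kop.
by move=> x _; rewrite -expr2; exact: Kop_sqr_le.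
Qed.

Lemma ip0 f g : (forall x, 0 < x <= 1 -> f x = 0) -> ip f g = 0.
Proof.
move=> f0; rewrite /ip (@eq_itg _ _ _ _ (fun=> 0)) ?itg_cst ?mul0r//.
by move=> x x01; rewrite f0// mul0r.
Qed.

Lemma Kop_null f x : bm 0 1 f -> ip f f = 0 -> Kop f x = 0.
Proof.
move=> bf f0; have := Kop_sqr_le x bf; rewrite f0 mulr0 => h.
by apply/eqP; rewrite -sqrf_eq0 eq_le h sqr_ge0.
Qed.

(** An Arzela-Ascoli argument: the diagonal choice controls the values at an enumeration of the
    rationals, and equicontinuity carries convergence to every x in (0, 1]. *)
Lemma pointwise_limit (g : nat -> R -> R) B : 0 <= B ->
  (forall k, exists2 f, bm 0 1 f /\ ip f f <= B & g k = Kop f) ->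
  exists (s : nat -> nat) (h : R -> R), (forall k, (k <= s k)%N) /\
    forall x, 0 < x <= 1 -> (fun k => g (s k) x) @ \oo --> h x.
Proof.
move=> B0 gP.
pose q i : R := ratr (odflt 0 (unpickle i : option rat)).
have gB n x : `|g n x| <= 1 + B.
  have [f [bf fB] ->] := gP n; have := Kop_sqr_le x bf.
  rewrite -real_normK ?num_real//.
  by have := sqr_ge0 (`|Kop f x| - 1); rewrite !expr2; lra.
have [p [s [ks hs]]] := @diagonal_subsequence R (fun n i => g n (q i)) (1 + B) (fun n i => gB n (q i)).
suff cg x : 0 < x <= 1 -> cvg ((fun k => g (s k) x) @ \oo).
  by exists s, (fun x => lim ((fun k => g (s k) x) @ \oo)); split.
move=> x01; apply: cauchy_cvg; apply: cauchy_exP => e e0.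
have e4 : 0 < e / 4 by rewrite divr_gt0.
have [d /andP[d0 dx] hd] := equicontinuous_Kop x01 e4 B0.
have [r] := @rat_in_itvoo R (x - d) x ltac:(lra).
rewrite in_itv/= => /andP[r1 r2].
pose i := pickle r; have qi : q i = ratr r by rewrite /q /i pickleK.
exists (p i); have [K hK] := natV_small e4.
exists (maxn K i) => // k /=; rewrite geq_max => /andP[Kk ik].
rewrite /ball/=.
have h1 := hs k i ik; rewrite qi in h1.
have h2 : `|g (s k) x - g (s k) (ratr r)| <= e / 4.
  have [f [bf fB] ->] := gP (s k); apply: hd => //.
  by rewrite r1 ltW.
have h3 : k.+1%:R^-1 <= K.+1%:R^-1 :> R by rewrite lef_pV2 ?posrE// ler_nat.
have {}h1 : `|g (s k) (ratr r) - p i| < e / 4 by apply: lt_trans h1 _; exact: le_lt_trans h3 hK.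
rewrite (_ : p i - g (s k) x = - (g (s k) (ratr r) - p i) - (g (s k) x - g (s k) (ratr r))); last by ring.
apply: le_lt_trans (ler_normB _ _) _; rewrite normrN; lra.
Qed.

Variables (phi : nat -> R -> R) (lam : nat -> R).
Hypothesis bphi : forall j, bm 0 1 (phi j).
Hypothesis lam0 : forall j, lam j != 0.
Hypothesis phiE : forall j x, 0 < x <= 1 -> phi j x = lam j * Kop (phi j) x.
Hypothesis maximal : forall psi mu, bm 0 1 psi ->
  (forall x, 0 <= x <= 1 -> psi x = mu * Kop psi x) -> 0 < ip psi psi ->
  ~ (forall j, ip psi (phi j) = 0).

Let orth f := bm 0 1 f /\ forall j, ip f (phi j) = 0.

Let ip_Kop_phi f j : bm 0 1 f -> lam j * ip (Kop f) (phi j) = ip f (phi j).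
Proof.
move=> bf; rewrite ip_Kop// (ipC f (Kop _)) -ipZl//; last exact: bm_Kop.
by rewrite (ipC f (phi j)); apply: eq_ipl => x x01; rewrite -phiE.
Qed.

Let orth_Kop f : orth f -> orth (Kop f).
Proof.
move=> [bf of_]; split; first exact: bm_Kop.
move=> j; apply: (mulfI (lam0 j)); rewrite mulr0 ip_Kop_phi//.
Qed.

Let orthZ f c : orth f -> orth (fun x => c * f x).
Proof.
by move=> [bf of_]; split; [exact: bmZ|move=> j; rewrite ipZl// of_ mulr0].
Qed.

Let orthD f g : orth f -> orth g -> orth (fun x => f x + g x).
Proof.
move=> [bf of_] [bg og]; split; first exact: bmD.
by move=> j; rewrite ipDl// of_ og addr0.
Qed.

(** For s = c and s = -c, psi = K f + s f satisfies K psi = s psi and is orthogonal to all phi_j, so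
    both are null by maximality; their difference is 2 c f. *)
Let no_square_eigen f c : 0 < c -> orth f -> 0 < ip f f ->
  (forall x, 0 < x <= 1 -> Kop (Kop f) x = c ^+ 2 * f x) -> False.
Proof.
move=> c0 oF f0 ffE; have [bf _] := oF; have otf := orth_Kop oF.
have [btf _] := otf.
have no_eigen s : s ^+ 2 = c ^+ 2 -> s != 0 ->
    ip (fun x => Kop f x + s * f x) (fun x => Kop f x + s * f x) = 0.
  move=> sc s0; set psi := (fun x => _).
  have opsi : orth psi by apply: orthD => //; exact: orthZ.
  have [bpsi opsi'] := opsi.
  have psiE x : 0 < x <= 1 -> psi x = s^-1 * Kop psi x.
    move=> x01; rewrite /psi KopD//; last exact: bmZ.
    by rewrite KopZ// ffE// -sc; field.
  (* The equation for psi is known on (0, 1]; psi' agrees with psi there and satisfies it at 0 as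
     well. *)
  pose psi' x := s^-1 * Kop psi x.
  have pp x : 0 < x <= 1 -> psi' x = psi x by move=> /psiE ->.
  have bpsi' : bm 0 1 psi' by apply: bmZ; exact: bm_Kop.
  have ipE : ip psi' psi' = ip psi psi by apply: eq_itg => x x01; rewrite pp.
  apply/eqP; rewrite eq_le ip_ge0 andbT leNgt; apply/negP; rewrite -ipE => psi0.
  apply: (maximal bpsi' _ psi0).
    by move=> x _; rewrite {1}/psi'; congr (_ * _); apply: eq_Kop => y y01; rewrite pp.
  by move=> j; rewrite (eq_ipl _ pp) opsi'.
have E1 := no_eigen c (erefl _) (lt0r_neq0 c0).
have E2 := no_eigen (- c) (sqrrN c) _; rewrite oppr_eq0 in E2.
have {}E2 := E2 (lt0r_neq0 c0).
have b1 : bm 0 1 (fun x => Kop f x + c * f x) by apply: bmD => //; exact: bmZ.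
have b2 : bm 0 1 (fun x => Kop f x + - c * f x) by apply: bmD => //; exact: bmZ.
have := ip_lincomb 1 (-1) b1 b2; rewrite E1 E2 !mulr0 add0r addr0.
have -> : ip (fun x => Kop f x + c * f x) (fun x => Kop f x + - c * f x) = 0.
  have := cauchy_schwarz b1 b2; rewrite E1 mul0r => h.
  by apply/eqP; rewrite -sqrf_eq0 eq_le h sqr_ge0.
rewrite mulr0 => E.
have : ip (fun x => 2 * c * f x) (fun x => 2 * c * f x) = 0.
  rewrite -[RHS]E; apply: eq_itg => x _; ring.
rewrite ipZl//; last exact: bmZ.
rewrite ipC ipZl// => /eqP; rewrite !mulf_eq0 pnatr_eq0/=.
by rewrite !gt_eqF.
Qed.

(* Otherwise ||K g|| / ||g|| has a positive supremum over the g orthogonal to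
   all phi_j; a limit of K g_n for a maximizing sequence g_n is an eigenfunction
   of K^2 orthogonal to all phi_j. *)
Lemma Kop_orth_null f : bm 0 1 f -> (forall j, ip f (phi j) = 0) ->
  ip (Kop f) (Kop f) = 0.
Proof.
move=> bf of_; apply/eqP; apply: contrapT => /negP tf0.
pose S := [set v | exists g, [/\ orth g, ip g g <= 1 & v = ip (Kop g) (Kop g)]].
have S4 v : S v -> v <= 4^-1.
  move=> [g [[bg _] g1 ->]]; apply: le_trans (ip_Kop_le bg) _.
  by rewrite ler_piMr ?invr_ge0.
have scaled g : orth g -> ip g g != 0 -> S ((ip g g)^-1 * ip (Kop g) (Kop g)).
  move=> og g0; have [bg _] := og; have gp : 0 < ip g g by rewrite lt_neqAle eq_sym g0 ip_ge0.
  pose t := (Num.sqrt (ip g g))^-1.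
  have t2 : t * t = (ip g g)^-1 by rewrite -invfM -expr2 sqr_sqrtr ?ip_ge0.
  exists (fun x => t * g x); split; first exact: orthZ.
    rewrite ipZl//; last exact: bmZ.
    by rewrite ipC ipZl// mulrA t2 mulVf.
  have -> : ip (Kop (fun x => t * g x)) (Kop (fun x => t * g x)) =
      ip (fun x => t * Kop g x) (fun x => t * Kop g x).
    by apply: eq_itg => x _; rewrite KopZ.
  have btg := bm_Kop bg.
  rewrite ipZl//; last exact: bmZ.
  by rewrite ipC ipZl// mulrA t2.
have f0 : ip f f != 0.
  by apply: contraNneq tf0 => f0; apply/eqP/ip0 => x _; exact: Kop_null.
have Sf := scaled f (conj bf of_) f0.
have hS : has_sup S.
  by split; [exists ((ip f f)^-1 * ip (Kop f) (Kop f))|exists 4^-1 => v; exact: S4].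
pose C2 := sup S.
have C20 : 0 < C2.
  apply: lt_le_trans (ub_le_sup hS.2 Sf).
  by rewrite mulr_gt0 ?invr_gt0// lt_neqAle eq_sym ip_ge0 andbT.
have leC g : orth g -> ip (Kop g) (Kop g) <= C2 * ip g g.
  move=> og; have [bg _] := og; case: (eqVneq (ip g g) 0) => [g0|g0].
    by rewrite g0 mulr0 le_eqVlt; apply/orP; left; apply/eqP/ip0 => x _; exact: Kop_null.
  have gp : 0 < ip g g by rewrite lt_neqAle eq_sym g0 ip_ge0.
  by have := ub_le_sup hS.2 (scaled g og g0); rewrite mulrC ler_pdivrMr.
have ex (n : nat) : exists g, [/\ orth g, ip g g <= 1 &
    C2 - n.+1%:R^-1 < ip (Kop g) (Kop g)].
  have n0 : 0 < n.+1%:R^-1 :> R by rewrite invr_gt0.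
  by have [_ [g [og g1 ->]] hg] := sup_adherent n0 hS; exists g.
have [F hF] := choice ex.
have oF n : orth (F n) by case: (hF n).
have bF n : bm 0 1 (F n) by case: (oF n).
have F1 n : ip (F n) (F n) <= 1 by case: (hF n).
have [s [h [ks hlim]]] := @pointwise_limit (fun n => Kop (F n)) 1 ler01
  (fun n => ex_intro2 _ _ (F n) (conj (bF n) (F1 n)) (erefl _)).
pose G k := Kop (F (s k)).
have oG k : orth (G k) by exact: orth_Kop.
have bG k : bm 0 1 (G k) by case: (oG k).
have G1 k x : `|G k x| <= 1.
  rewrite -(@ler_sqr _ _ 1) ?nnegrE// real_normK ?num_real// expr1n.
  by have := Kop_sqr_le x (bF (s k)); have := F1 (s k); rewrite -/(G k); lra.
have G1' k x : 0 < x <= 1 -> `|G k x| <= 1 by [].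
have bh : bm 0 1 h := bm_cvg bG G1' hlim.
have itglim u M : bm 0 1 u -> (forall x, 0 < x <= 1 -> `|u x| <= M) ->
    (fun k => itg 0 1 (fun x => u x * G k x)) @ \oo --> itg 0 1 (fun x => u x * h x).
  move=> bu uM; apply: (@itg_cvg _ _ _ M).
  - by move=> k; exact: bmM.
  - by move=> k x x01; rewrite normrM -[leRHS]mulr1 ler_pM// uM.
  - by move=> x x01; apply: cvgM; [exact: cvg_cst|exact: hlim].
have toplim x : (fun k => Kop (G k) x) @ \oo --> Kop h x.
  by apply: (itglim _ 2^-1); [exact: bm_kap|move=> y _; exact: kap_bound].
have TG1 k x : `|Kop (G k) x| <= 1.
  have := itg_bound ler01 (bm_kapM x (bG k)) (M := 1); rewrite subr0 mulr1; apply => y _.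
  rewrite normrM -[leRHS]mulr1 ler_pM//.
  by apply: le_trans (kap_bound _) _; lra.
have toptoplim x : (fun k => Kop (Kop (G k)) x) @ \oo --> Kop (Kop h) x.
  apply: (@itg_cvg _ _ _ 1).
  - by move=> k; apply: bm_kapM; exact: bm_Kop.
  - move=> k y _; rewrite normrM -[leRHS]mulr1 ler_pM//.
    by apply: le_trans (kap_bound _) _; lra.
  - by move=> y _; apply: cvgM; [exact: cvg_cst|exact: toplim].
have oh : orth h.
  split => // j; rewrite ipC; have [_ [M pM]] := bphi j.
  have := itglim _ _ (bphi j) pM.
  rewrite (_ : (fun k => _) = fun=> 0).
    by move=> c0; rewrite /ip -(cvg_lim _ c0)// lim_cst.
  by apply/funext => k; rewrite -/(ip _ _) ipC; case: (oG k).
(* The squared norms of the G k exceed C2 - 1/(s k + 1), so the limit h is not null. *)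
have hh : C2 <= ip h h.
  have cG : (fun k => ip (G k) (G k)) @ \oo --> ip h h.
    apply: (@itg_cvg _ _ _ 1).
    - by move=> k; exact: bmM.
    - by move=> k x x01; rewrite normrM -[leRHS]mulr1 ler_pM.
    - by move=> x x01; apply: cvgM; exact: hlim.
  apply/ler_addgt0Pr => e e0; have [K hK] := natV_small e0.
  rewrite -lerBlDr -(cvg_lim _ cG)//; apply: limr_ge; first exact: cvgP cG.
  exists K => // k /= Kk; case: (hF (s k)) => _ _ hk.
  apply: ltW; apply: le_lt_trans hk; rewrite lerD2l lerN2.
  apply: le_trans (ltW hK); rewrite lef_pV2 ?posrE// ler_nat ltnS.
  exact: leq_trans Kk (ks k).
(* With F = F_{s k} and G = K F, the value is K r (x) for r = K G - C2 F. From <K G, F> = ||G||^2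
   and ||K G||^2 <= C2 ||G||^2 follows ||r||^2 <= C2 (C2 - ||G||^2). *)
have resid k x : (Kop (Kop (G k)) x - C2 * G k x) ^+ 2 <= C2 * (s k).+1%:R^-1.
  pose r y := 1 * Kop (G k) y + - C2 * F (s k) y.
  have btG := bm_Kop (bG k).
  have br : bm 0 1 r by apply: bmD; exact: bmZ.
  have -> : Kop (Kop (G k)) x - C2 * G k x = Kop r x.
    by rewrite /r KopD; [rewrite !KopZ// /G; ring|exact: bmZ|exact: bmZ].
  apply: le_trans (Kop_sqr_le x br) _.
  have e1 : ip (Kop (G k)) (F (s k)) = ip (G k) (G k) by rewrite ip_Kop.
  have := leC _ (oG k); have := F1 (s k); case: (hF (s k)) => _ _; rewrite -/(G k).
  have := ip_ge0 r; rewrite /r ip_lincomb// e1.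
  move: (ip (Kop (G k)) _) (ip (G k) _) (ip (F (s k)) _) ((s k).+1%:R^-1) => u v w z.
  rewrite expr1n mul1r sqrrN mulr1 => hr hz hw hu.
  have a1 : C2 * (C2 - z) <= C2 * v by rewrite ler_wpM2l// ltW.
  have a2 : C2 ^+ 2 * w <= C2 ^+ 2 by rewrite ler_piMr// sqr_ge0.
  rewrite !expr2 in a2 hr *; lra.
have hE x : 0 < x <= 1 -> Kop (Kop h) x = C2 * h x.
  move=> x01; apply/eqP; rewrite -subr_eq0 -sqrf_eq0 eq_le sqr_ge0 andbT.
  have cl : (fun k => (Kop (Kop (G k)) x - C2 * G k x) ^+ 2) @ \oo -->
      (Kop (Kop h) x - C2 * h x) ^+ 2.
    have cb : (fun k => Kop (Kop (G k)) x - C2 * G k x) @ \oo --> Kop (Kop h) x - C2 * h x.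
      apply: cvgB; first exact: toptoplim.
      by apply: cvgM; [exact: cvg_cst|exact: hlim].
    rewrite expr2; under eq_fun do rewrite expr2; exact: cvgM.
  apply/ler_addgt0Pr => e e0; rewrite add0r.
  have [K hK] := natV_small (divr_gt0 e0 C20).
  rewrite -(cvg_lim _ cl)//; apply: limr_le; first exact: cvgP cl.
  exists K => // k /= Kk; apply: le_trans (resid k x) _.
  rewrite mulrC -ler_pdivlMr//; apply: le_trans (ltW hK).
  rewrite lef_pV2 ?posrE// ler_nat ltnS; exact: leq_trans Kk (ks k).
have c0 : 0 < Num.sqrt C2 by rewrite sqrtr_gt0.
apply: (no_square_eigen c0 oh (lt_le_trans C20 hh)) => x x01.
by rewrite sqr_sqrtr ?(ltW C20)// hE.
Qed.

End Spectral.

(** * Fourier remainders and uniform convergence *)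

Section Expansion.
Variable R : realType.
Implicit Types (a b c d e x y z t M B : R) (f g : R -> R).
Variables (phi : nat -> R -> R) (lam : nat -> R).
Hypothesis bphi : forall j, bm 0 1 (phi j).
Hypothesis lam0 : forall j, lam j != 0.
Hypothesis phiE : forall j x, 0 < x <= 1 -> phi j x = lam j * Kop (phi j) x.
Hypothesis maximal : forall psi mu, bm 0 1 psi ->
  (forall x, 0 <= x <= 1 -> psi x = mu * Kop psi x) -> 0 < ip psi psi ->
  ~ (forall j, ip psi (phi j) = 0).
Hypothesis orthonormal : forall i j, ip (phi i) (phi j) = (i == j)%:R.

Definition fourier_rest f n x : R := f x - \sum_(h < n) ip f (phi h) * phi h x.

Variable q : R -> R.
Hypothesis bq : bm 0 1 q.

Let rest := fourier_rest q.
Let b h := ip q (phi h).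
Let En n := ip (rest n) (rest n).

Let bterm h : bm 0 1 (fun x => b h * phi h x). Proof. exact: bmZ. Qed.

Let brest n : bm 0 1 (rest n).
Proof. by apply: bmB => //; exact: (@bm_sum _ _ _ (fun h x => b h * phi h x)). Qed.

Let ip_rest n g : bm 0 1 g ->
  ip (rest n) g = ip q g - \sum_(h < n) b h * ip (phi h) g.
Proof.
move=> bg; rewrite /rest /fourier_rest ipBl//; last exact: (@bm_sum _ _ _ (fun h x => b h * phi h x)).
rewrite (@ip_suml _ (fun h x => b h * phi h x))//; congr (_ - _).
by apply: eq_bigr => h _; rewrite ipZl.
Qed.

Let rest_orth n j : (j < n)%N -> ip (rest n) (phi j) = 0.
Proof.
move=> jn; rewrite ip_rest// (bigD1 (Ordinal jn))//= orthonormal eqxx mulr1.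
rewrite big1 ?addr0 ?subrr// => i ij; rewrite orthonormal.
by rewrite (_ : (i == j :> nat) = false) ?mulr0//; apply/negbTE.
Qed.

(** R_m - R_n lies in the span of the phi_h with h < n, to which R_n is orthogonal. *)
Let ip_rest_rest m n : (m <= n)%N -> ip (rest m) (rest n) = En n.
Proof.
have H k : (k <= n)%N -> ip (rest k) (rest n) = ip q (rest n).
  move=> kn; rewrite ip_rest// big1 ?subr0// => i _.
  by rewrite ipC rest_orth ?mulr0// (leq_trans (ltn_ord i)).
by move=> mn; rewrite H// /En H.
Qed.

Let ip_rest_diff m n : (m <= n)%N ->
  ip (fun x => rest m x - rest n x) (fun x => rest m x - rest n x) = En m - En n.
Proof.
move=> mn; transitivity (ip (fun x => 1 * rest m x + -1 * rest n x)
   (fun x => 1 * rest m x + -1 * rest n x)).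
  by apply: eq_itg => x _; ring.
by rewrite ip_lincomb// (ip_rest_rest mn) /En; ring.
Qed.

Lemma bessel n : \sum_(h < n) ip q (phi h) ^+ 2 <= ip q q.
Proof.
have : 0 <= En n by exact: ip_ge0.
(* ||R_n||^2 = <R_n, R_0>, and R_0 = q because the sum is empty. *)
rewrite -(ip_rest_rest (leq0n n)) ipC ip_rest//.
have -> : ip q (rest 0) = ip q q.
  by apply: eq_itg => x _; rewrite /rest /fourier_rest big_ord0 subr0.
rewrite subr_ge0; congr (_ <= _); apply: eq_bigr => h _.
rewrite expr2; congr (_ * _); rewrite ipC; apply: eq_ipl => x _.
by rewrite /rest /fourier_rest big_ord0 subr0.
Qed.

(** The squared norms of the remainders are nonincreasing and bounded below, so they approach their
    infimum. *)
Let En_cauchy e : 0 < e -> exists N, forall m n, (N <= m)%N -> (m <= n)%N -> En m - En n <= e.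
Proof.
move=> e0; pose S := [set En n | n in [set: nat]].
have hS : has_inf S.
  split; first by exists (En 0), 0%N.
  by exists 0 => _ [n _ <-]; exact: ip_ge0.
have mono m n : (m <= n)%N -> En n <= En m.
  by move=> mn; rewrite -subr_ge0 -ip_rest_diff// ip_ge0.
have [_ [N _ <-] hN] := inf_adherent e0 hS.
exists N => m n Nm mn; have := mono _ _ Nm.
have : inf S <= En n by apply: (ge_inf hS.2); exists n.
rewrite -/S in hN; lra.
Qed.

Let Kop_rest_cauchy e : 0 < e -> exists N, forall m n x, (N <= m)%N -> (m <= n)%N ->
  `|Kop (rest m) x - Kop (rest n) x| <= e.
Proof.
move=> e0; have [N hN] := En_cauchy (exprn_gt0 2 e0).
exists N => m n x Nm mn; have := hN m n Nm mn; rewrite -ip_rest_diff// => h.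
rewrite -(@ler_sqr _ _ e) ?nnegrE ?(ltW e0)// real_normK ?num_real// -KopB//.
have := Kop_sqr_le x (bmB (brest m) (brest n)).
have := ip_ge0 (fun x => rest m x - rest n x); lra.
Qed.

Lemma fourier_rest_Kop e : 0 < e -> exists N, forall n x, (N <= n)%N -> 0 <= x <= 1 ->
  `|Kop (fourier_rest q n) x| < e.
Proof.
move=> e0.
have cv x : cvg ((fun n => Kop (rest n) x) @ \oo).
  apply: cauchy_cvg; apply: cauchy_exP => d d0.
  have [N hN] := Kop_rest_cauchy (divr_gt0 d0 (ltr0n R 2)).
  exists (Kop (rest N) x), N => // n /= Nn; rewrite /ball/=.
  by have := hN N n x (leqnn N) Nn; lra.
pose v x := lim ((fun n => Kop (rest n) x) @ \oo).
have vlim x : (fun n => Kop (rest n) x) @ \oo --> v x by exact: cv.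
have E0 n : En n <= En 0 by rewrite -subr_ge0 -ip_rest_diff// ip_ge0.
have restB n x : `|Kop (rest n) x| <= 1 + En 0.
  have := Kop_sqr_le x (brest n); have := E0 n; rewrite -/(En n).
  have := ip_ge0 (rest n); rewrite -/(En n) -real_normK ?num_real//.
  by have := sqr_ge0 (`|Kop (rest n) x| - 1); rewrite !expr2; lra.
have btr n : bm 0 1 (Kop (rest n)) by exact: bm_Kop.
have bv : bm 0 1 v by apply: (bm_cvg btr (fun n x _ => restB n x)) => x _; exact: vlim.
have ipvlim g : bm 0 1 g -> (fun n => ip (Kop (rest n)) g) @ \oo --> ip v g.
  move=> bg; have [_ [M gM]] := bg.
  apply: (@itg_cvg _ _ _ ((1 + En 0) * M)).
  - by move=> n; exact: bmM.
  - by move=> n x x01; rewrite normrM ler_pM// gM.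
  - by move=> x x01; apply: cvgM; [exact: vlim|exact: cvg_cst].
(* <K R_n, phi_j> = <R_n, phi_j> / lam_j vanishes as soon as n > j. *)
have vorth j : ip v (phi j) = 0.
  apply: (cvg_unique _ (ipvlim _ (bphi j))) => //.
  apply: (cvg_near_cst); exists j.+1 => // n /= jn; apply/esym/(mulfI (lam0 j)).
  rewrite mulr0 ip_Kop// ipC -ipZl//; last exact: bm_Kop.
  rewrite -[LHS](rest_orth jn) [LHS]ipC; apply: eq_ipl => x x01.
  by rewrite -phiE.
have tv0 := Kop_orth_null bphi lam0 phiE maximal bv vorth.
(* <v, v> is the limit of <K R_n, v> = <R_n, K v>, and K v is null because v is orthogonal to all
   phi_j. *)
have vv0 : ip v v = 0.
  apply: (cvg_unique _ (ipvlim _ bv)) => //.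
  apply: cvg_near_cst; apply: nearW => n; apply/eqP.
  rewrite ip_Kop// -sqrf_eq0 eq_le sqr_ge0 andbT.
  by have := cauchy_schwarz (brest n) (bm_Kop bv); rewrite tv0 mulr0.
(* Equicontinuity passes to v: a nonzero v x would give |v| >= |v x| / 2 on a left neighbourhood of
   x, hence a positive norm. *)
have v0 x : 0 < x <= 1 -> v x = 0.
  move=> x01; apply/eqP; rewrite -normr_le0 leNgt; apply/negP => vx.
  have vx2 : 0 < `|v x| / 2 by rewrite divr_gt0.
  have [d /andP[d0 dx] hd] := equicontinuous_Kop x01 vx2 (ip_ge0 (rest 0)).
  have vd x' : x - d < x' <= x -> (`|v x| / 2) ^+ 2 <= v x' * v x'.
    move=> x'd; have cl : (fun n => `|Kop (rest n) x - Kop (rest n) x'|) @ \oo --> `|v x - v x'|.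
      by apply: cvg_norm; apply: cvgB; exact: vlim.
    have h : `|v x - v x'| <= `|v x| / 2.
      rewrite -(cvg_lim _ cl)//; apply: limr_le; first exact: cvgP cl.
      by apply: nearW => n; apply: hd => //; exact: E0.
    have h2 : `|v x| / 2 <= `|v x'|.
      have := ler_normD (v x - v x') (v x'); rewrite subrK; lra.
    by rewrite -expr2 -[leRHS]real_normK ?num_real// ler_sqr ?nnegrE// ltW.
  have /andP[x0 x1] := x01.
  have xd0 : 0 <= x - d by lra.
  have xdx : x - d <= x by lra.
  have h1 : itg (x - d) x (fun y => v y * v y) <= ip v v.
    apply: itg_subset => //; first exact: bmM.
    by move=> y _; rewrite -expr2 sqr_ge0.
  have h2 : (`|v x| / 2) ^+ 2 * (x - (x - d)) <= itg (x - d) x (fun y => v y * v y).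
    rewrite -itg_cst//; apply: itg_le => //; first exact: bm_cst.
    by apply: (@bmS _ 0 1) => //; exact: bmM.
  have h3 : 0 < (`|v x| / 2) ^+ 2 * (x - (x - d)).
    by rewrite mulr_gt0 ?exprn_gt0//; lra.
  by move: h1; rewrite vv0; lra.
have [N hN] := Kop_rest_cauchy (divr_gt0 e0 (ltr0n R 2)).
exists N => n x Nn /andP[x0 x1].
move: x0; rewrite le_eqVlt => /orP[/eqP <-|x0]; first by rewrite Kop0 normr0.
have cl : (fun m => `|Kop (rest n) x - Kop (rest m) x|) @ \oo --> `|Kop (rest n) x - v x|.
  by apply: cvg_norm; apply: cvgB; [exact: cvg_cst|exact: vlim].
rewrite -/(rest n) -[Kop (rest n) x]subr0 -(v0 x) ?x0//.
apply: (@le_lt_trans _ _ (e / 2)); last by lra.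
rewrite -(cvg_lim _ cl)//; apply: limr_le; first exact: cvgP cl.
by exists n => // m /= nm; exact: hN.
Qed.

End Expansion.

(** * Eigenfunctions in L^2 as bounded measurable functions *)

Section Bridge.
Variable R : realType.
Implicit Types (x y : R) (f g : R -> R).

Lemma in_I01 x : I01 x = (0 <= x <= 1) :> Prop.
Proof. by rewrite /I01/= in_itv. Qed.

Lemma leb_I01_lty : (@leb R (@I01 R) < +oo)%E.
Proof. by rewrite /leb /I01 lebesgue_measure_itv/=; case: ifP; rewrite ?ltry. Qed.

Lemma Rintegral_I01 f : bm 0 1 f -> \int[@leb R]_(x in @I01 R) f x = itg 0 1 f.
Proof.
by move=> bf; rewrite /itg Rintegral_itv_obnd_cbnd//; exact: bm_integrable.
Qed.

Lemma inner_ip f g : bm 0 1 f -> bm 0 1 g -> inner f g = ip f g.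
Proof. by move=> bf bg; rewrite /inner Rintegral_I01//; exact: bmM. Qed.

Lemma Rintegral_K f x : bm 0 1 f -> 0 <= x ->
  \int[@leb R]_(y in @I01 R) (K x y * f y) = Kop f x.
Proof.
move=> bf x0; have E y : 0 < y <= 1 -> kap (x * y) * f y = K x y * f y.
  by move=> /andP[y0 _]; rewrite K_kap// ltW.
rewrite Rintegral_I01; last by apply: eq_bm E _; exact: bm_kapM.
by apply: eq_itg => y y01; rewrite E.
Qed.

(** From |f| <= 1 + f^2 an eigenfunction is integrable; as the kernel is bounded by 1/2, the
    eigenvalue equation then bounds f pointwise by |lam| times its L^1 norm. *)
Lemma eigenfun_bm f lam : eigenfun f lam -> bm 0 1 f.
Proof.
move=> [[mf if2] [_ fE]].
have mI : measurable (@I01 R : set (measurableTypeR R)) by exact: measurable_itv.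
have if1 : (@leb R).-integrable (@I01 R) (EFin \o f).
  have i1 : (@leb R).-integrable (@I01 R) (EFin \o (fun=> 1)).
    apply: measurable_bounded_integrable => //.
      exact: leb_I01_lty.
    by exists 1; split => // N N1 x _ /=; rewrite normr1 ltW.
  apply: (le_integrable mI _ _ (integrableD mI i1 if2)).
    exact/measurable_EFinP.
  move=> x _ /=; rewrite lee_fin [leRHS]ger0_norm ?addr_ge0 ?sqr_ge0//.
  rewrite -[f x ^+ 2]real_normK ?num_real//.
  by have := sqr_ge0 (`|f x| - 1); have := normr_ge0 (f x); rewrite !expr2; lra.
split; first by apply: measurable_funS mf => //; exact: subset_itv_oc_cc.
exists (`|lam| * \int[@leb R]_(y in @I01 R) `|f y|) => x /andP[x0 x1].
rewrite fE; last by rewrite in_I01 (ltW x0).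
rewrite normrM ler_wpM2l//.
have mk : measurable_fun (@I01 R) (fun y => kap (x * y)).
  apply: measurable_funTS; apply: (measurableT_comp (@measurable_kap R)).
  exact: mulrl_measurable.
have Kf y : I01 y -> K x y * f y = kap (x * y) * f y.
  by rewrite in_I01 => /andP[y0 _]; rewrite K_kap// ltW.
have -> : \int[@leb R]_(y in @I01 R) (K x y * f y) =
    \int[@leb R]_(y in @I01 R) (kap (x * y) * f y).
  by apply: eq_Rintegral => y; rewrite inE => /Kf.
have kf y : `|kap (x * y) * f y| <= `|f y|.
  rewrite normrM ler_piMl//; apply: le_trans (kap_bound _) _; lra.
have ikf : (@leb R).-integrable (@I01 R) (EFin \o (fun y => kap (x * y) * f y)).
  apply: (le_integrable mI _ _ if1); first exact/measurable_EFinP/measurable_funM.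
  by move=> y _ /=; rewrite lee_fin.
apply: le_trans (le_normr_Rintegral mI ikf) _.
apply: le_Rintegral => //.
- by have := integrable_abse ikf; apply: eq_integrable => // y _.
- by have := integrable_abse if1; apply: eq_integrable => // y _.
Qed.

Lemma eigenfun_Kop f lam : eigenfun f lam ->
  forall x, 0 <= x <= 1 -> f x = lam * Kop f x.
Proof.
move=> ef x x01; have bf := eigenfun_bm ef; case: ef => _ [_ ->].
  by rewrite Rintegral_K//; case/andP: x01.
by rewrite in_I01.
Qed.

Lemma Kop_eigenfun f mu : bm 0 1 f -> (forall x, 0 <= x <= 1 -> f x = mu * Kop f x) ->
  0 < ip f f -> eigenfun f mu.
Proof.
move=> bf fE f0; have [mf [M fM]] := bf.
have mI : measurable (@I01 R : set (measurableTypeR R)) by exact: measurable_itv.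
have mfI : measurable_fun (@I01 R) f by exact/measurable_fun_itv_obnd_cbndP.
split; last split.
- split => //; rewrite -[X in integrable _ _ X]/(EFin \o (fun x => f x ^+ 2)).
  apply: measurable_bounded_integrable => //.
  + exact: leb_I01_lty.
  + exact: measurable_funX.
  + exists (M ^+ 2); split; first exact: num_real.
    (* The bound M covers (0, 1] only; at 0 the equation itself gives the value. *)
    have f00 : f 0 = 0 by rewrite fE ?lexx ?ler01// Kop0 mulr0.
    have M0 : 0 <= M by apply: le_trans (fM 1 _); rewrite ?ltr01 ?lexx.
    move=> N MN x; rewrite in_I01 le_eqVlt => /andP[/orP[/eqP <-|x0] x1] /=.
      by rewrite f00 expr0n normr0 (le_trans (sqr_ge0 M))// ltW.
    by apply: le_trans (ltW MN); rewrite normrX ler_sqr ?nnegrE// fM// x0.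
- by rewrite /l2norm sqrtr_gt0 inner_ip.
- move=> x; rewrite in_I01 => x01; rewrite Rintegral_K//; last by case/andP: x01.
  exact: fE.
Qed.

End Bridge.

Theorem theorem4p16 (R : realType) (phi : nat -> R -> R) (lam : nat -> R)
  (j : nat) :
  eigen_system phi lam ->
  let P := PofQ (phi j) (lam j) in
  let a := fun h => inner P (phi h) in
  (* absolute convergence at every point of [0,1] *)
  (forall x, I01 x ->
     cvg ((fun n => \sum_(h < n) `|a h * phi h x|) @ \oo)) /\
  (* uniform convergence on [0,1] of the series to P *)
  (forall e : R, 0 < e -> exists N : nat, forall n : nat, (N <= n)%N ->
     forall x, I01 x -> `|\sum_(h < n) a h * phi h x - P x| < e).
Proof.
move=> [eig [orth [maxi _]]] P a.
have lam0 h : lam h != 0 by case: (eig h).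
have bphi h : bm 0 1 (phi h) by case: (eig h) => _; exact: eigenfun_bm.
have phiE01 h x : 0 <= x <= 1 -> phi h x = lam h * Kop (phi h) x.
  by case: (eig h) => _ /eigenfun_Kop; exact.
have phiE h x : 0 < x <= 1 -> phi h x = lam h * Kop (phi h) x.
  by move=> /andP[x0 x1]; rewrite phiE01// (ltW x0).
have orthonormal i h : ip (phi i) (phi h) = (i == h)%:R.
  by rewrite -inner_ip// orth.
have maximal psi mu : bm 0 1 psi ->
    (forall x, 0 <= x <= 1 -> psi x = mu * Kop psi x) -> 0 < ip psi psi ->
    ~ (forall h, ip psi (phi h) = 0).
  move=> bpsi psiE psi0 psiO; apply: (maxi psi mu); first exact: Kop_eigenfun.
  by move=> h; rewrite inner_ip.
set q := QofPhi (phi j).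
have bq : bm 0 1 q.
  have [_ [C phiC]] := bphi j.
  apply: bm_QofPhi => //.
    by move=> d; exact: (eigen_lipschitz (bphi j) (phiE j) phiC).
  exact: (eigen_log_lipschitz (bphi j) (phiE j) phiC).
have PE x : 0 <= x <= 1 -> P x = - lam j * Kop q x.
  by move=> /andP[x0 _]; rewrite /P /PofQ Rintegral_K.
(* Self-adjointness moves K from q to phi_h, where it acts as division by lam_h. *)
have aE h : lam h * a h = - lam j * ip q (phi h).
  have btq := bm_Kop bq.
  have PE' x : 0 < x <= 1 -> - lam j * Kop q x = P x.
    by move=> /andP[x0 x1]; rewrite PE// (ltW x0).
  rewrite /a inner_ip//; last by apply: eq_bm PE' _; exact: bmZ.
  rewrite -(eq_ipl _ PE') ipZl// mulrCA; congr (_ * _).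
  rewrite ip_Kop// (ipC q (Kop _)) -ipZl//; last exact: bm_Kop.
  by rewrite (ipC q); apply: eq_ipl => x x01; rewrite -phiE.
have termE h x : 0 <= x <= 1 -> a h * phi h x = - lam j * (ip q (phi h) * Kop (phi h) x).
  by move=> x01; rewrite phiE01// mulrCA mulrA aE; ring.
split => [x|e e0].
  rewrite in_I01 => x01; apply: nondecreasing_is_cvgn.
    by apply/nondecreasing_seqP => n; rewrite big_ord_recr/= lerDl.
  exists (`|lam j| * (ip q q + 4^-1)) => _ [n _ <-].
  under eq_bigr do rewrite termE// normrM normrN.
  rewrite -mulr_sumr ler_wpM2l//.
  have b1 := bessel bphi orthonormal bq n.
  (* The Fourier coefficients of K(x, .) are the values K phi_h (x), so both sums in u w <= u^2 +
     w^2 are bounded by Bessel's inequality. *)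
  have b2 := bessel bphi orthonormal (bm_kap 0 1 x) n.
  have b3 := ip_kap_le x.
  apply: (@le_trans _ _ (\sum_(h < n) ip q (phi h) ^+ 2 + \sum_(h < n) Kop (phi h) x ^+ 2)).
    rewrite -big_split/=; apply: ler_sum => h _; rewrite normrM.
    rewrite -[X in _ <= X + _]real_normK ?num_real// -[X in _ <= _ + X]real_normK ?num_real//.
    set u := `|_|; set w := `|_|; have := sqr_ge0 (u - w).
    have := mulr_ge0 (normr_ge0 _ : 0 <= u) (normr_ge0 _ : 0 <= w).
    rewrite !expr2; lra.
  by rewrite lerD//; exact: le_trans b2 b3.
(* The error at x is |lam_j| |K R_n (x)|, so K R_n is taken below e / (|lam_j| + 1). *)
have l1 : 0 < `|lam j| + 1 by rewrite ltr_wpDl.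
have [N hN] := fourier_rest_Kop bphi lam0 phiE maximal orthonormal bq (divr_gt0 e0 l1).
exists N => n Nn x; rewrite in_I01 => x01.
have := hN n x Nn x01; rewrite ltr_pdivlMr// => h.
rewrite PE//; under eq_bigr do rewrite termE//.
have bS : bm 0 1 (fun y => \sum_(h < n) ip q (phi h) * phi h y).
  by apply: (bm_sum n (F := fun h y => ip q (phi h) * phi h y)) => i; exact: bmZ.
have tE : Kop (fourier_rest phi q n) x = Kop q x - \sum_(h < n) ip q (phi h) * Kop (phi h) x.
  rewrite /fourier_rest KopB// (@Kop_sum _ (fun h y => ip q (phi h) * phi h y)); last first.
    by move=> i; exact: bmZ.
  by congr (_ - _); apply: eq_bigr => i _; rewrite KopZ.
rewrite -mulr_sumr -mulrBr normrM normrN distrC -tE.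
by apply: le_lt_trans h; rewrite mulrC ler_wpM2l// lerDl.
Qed.
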